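(* Assume the standard conditions hold and that the hazard rate $h$ of $F$ satisfies: $h$ is regularly varying, $\lim_{t\to\infty}th(t)=+\infty$ and $\lim_{t\to\infty}h(t)=0$. Assume moreover (i) $h(t)=o(t^{-1}\log t)$ as $t\to\infty$; (ii) $\limsup_{t\to\infty} t\,h(t)^2/h\big(1/h(t)\big)<\infty$. Then for every positive integer $m$, as $t\to\infty$, $$\overline G(t)=\sum_{i\in\mathbb Z:\ c_i\succeq c_{(m)}}\overline{\mathsf M_{c_i}F}(t)+o\big(\overline{\mathsf M_{c_{(m)}}F}(t)\big).$$
   Context: Let $(X_i)_{i\in\mathbb Z}$ be independent random variables with common distribution function $F$. Let $(c_i)_{i\in\mathbb Z}$ be real weights tending to $0$ at infinity, and let $G$ be the distribution function of $\sum_{i\in\mathbb Z}c_iX_i$. For a distribution function $K$ write $\overline K=1-K$. For a real $c$, $\mathsf M_cK$ denotes the distribution function of $cY$ when $Y$ has distribution $K$; thus $\overline{\mathsf M_cK}(t)=\overline K(t/c)$ for $c>0$, and $\mathsf M_0K$ is the point mass at $0$. The hazard rate of $F$ is $h=F'/\overline F$, assumed to exist for all large $t$, so that $\overline F(t)=\overline F(t_0)\exp(-\int_{t_0}^t h(u)\,du)$ for $t\ge t_0$. $F$ is tail balanced if $\overline F(t)/F(-t)$ has a positive finite limit as $t\to\infty$; then $h_-$ denotes the hazard rate of $\mathsf M_{-1}F$. $F$ is strongly tail balanced if it is tail balanced and every property assumed of $h$ is also satisfied by $h_-$. The standard conditions are: $\sum_{i\in\mathbb Z}|c_i|^\delta<\infty$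 for some $\delta\in(0,1)$, and either $F$ vanishes on a neighborhood of $-\infty$ or $F$ is strongly tail balanced. Ordering of reals: $a\prec b$ means $\overline{\mathsf M_aF}=o(\overline{\mathsf M_bF})$ at infinity; $a\equiv b$ means there is $\epsilon>0$ with $\epsilon\overline{\mathsf M_aF}\le\overline{\mathsf M_bF}\le\epsilon^{-1}\overline{\mathsf M_aF}$ ultimately; $a\preceq b$ means $a\prec b$ or $a\equiv b$; $a\succ b$, $a\succeq b$ are the reverse relations. $(c_{(i)})_{i\ge1}$ denotes the weights $(c_i)$ listed in nonincreasing $\prec$-order without multiplicity (strictly $\prec$-decreasing, except that once it reaches an element $\equiv0$ it stays $0$).
   Formalization: The formal theorem assumes in addition that c_(m) is not ≡ 0; when c_(m) ≡ 0 the remainder o(0) would force an exact identity for large t, which fails e.g. for exactly two nonzero weights both equal to 1 and m = 2. *)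

(* Defs.v *)
From HB Require Import structures.
From mathcomp Require Import all_boot all_order all_algebra.
From mathcomp Require Import all_classical all_reals all_analysis.
Set Implicit Arguments. Unset Strict Implicit. Unset Printing Implicit Defensive.
Import Order.TTheory GRing.Theory Num.Theory.
Import numFieldNormedType.Exports.
Local Open Scope classical_set_scope.
Local Open Scope ring_scope.

Section Defs.
Variable R : realType.

(* Tail \overline{M_c K}(t) of the law of cY, Y with distribution function K:
   P(cY > t) = 1 - K(t/c) if c > 0, = K((t/c)-) if c < 0, = 1_{t<0} if c = 0. *)
Definition Mbar (K : R -> R) (c t : R) : R :=
  if 0 < c then 1 - K (t / c)
  else if c < 0 then lim (K s @[s --> (t / c)^'-])
  else (if t < 0 then 1 else 0).

Definition wprec (K : R -> R) (a b : R) : Prop :=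
  forall eps : R, 0 < eps ->
    \forall t \near +oo, `|Mbar K a t| <= eps * `|Mbar K b t|.

Definition wequiv (K : R -> R) (a b : R) : Prop :=
  exists2 eps : R, 0 < eps &
    \forall t \near +oo,
      eps * Mbar K a t <= Mbar K b t /\ Mbar K b t <= eps^-1 * Mbar K a t.

Definition wpreceq (K : R -> R) (a b : R) : Prop := wprec K a b \/ wequiv K a b.

Definition hazard_rate (Kbar h : R -> R) : Prop :=
  exists t0 : R, forall t, t0 <= t ->
    0 < Kbar t /\ is_derive t 1 (fun s => 1 - Kbar s) (h t * Kbar t).

Definition regularly_varying (f : R -> R) : Prop :=
  (\forall t \near +oo, 0 < f t) /\
  exists rho : R, forall lam : R, 0 < lam ->
    (f (lam * t) / f t) @[t --> +oo] --> lam `^ rho.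

Definition hazard_props (h : R -> R) : Prop :=
  [/\ regularly_varying h,
      (t * h t) @[t --> +oo] --> +oo,
      h t @[t --> +oo] --> 0,
      (h t / (ln t / t)) @[t --> +oo] --> 0
    &
      exists M : R, \forall t \near +oo, t * h t ^+ 2 / h (h t)^-1 <= M].

Definition psum (c : int -> R) (x : int -> R) (n : nat) : R :=
  \sum_(0 <= k < n.*2.+1) c (k%:Z - n%:Z) * x (k%:Z - n%:Z).

(* cs is the sequence (c_(k))_{k>=1} of the weights in nonincreasing ≺-order
   without multiplicity (strictly ≺-decreasing, except that once it reaches an
   element ≡ 0 it stays 0). *)
Definition ordered_weights (K : R -> R) (c : int -> R) (cs : nat -> R) : Prop :=
  [/\ forall k, (1 <= k)%N -> cs k = 0 \/ exists j, cs k = c j,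
      forall k, (1 <= k)%N -> wequiv K (cs k) 0 -> cs k.+1 = 0,
      forall k, (1 <= k)%N -> ~ wequiv K (cs k) 0 -> wprec K (cs k.+1) (cs k)
    & forall i, ~ wequiv K (c i) 0 -> exists2 k, (1 <= k)%N & wequiv K (c i) (cs k)].

Definition mutually_independent (d : measure_display) (T : measurableType d)
    (P : probability T R) (X : int -> T -> R) : Prop :=
  forall (S : seq int) (B : int -> set R), uniq S ->
    (forall i, measurable (B i)) ->
    P (\big[setI/setT]_(i <- S) (X i @^-1` B i)) =
    (\prod_(i <- S) P (X i @^-1` B i))%E.

End Defs.

(* Main.v *)
(* One big jump.  Write K for the common tail and k0 = |c_(m)|.  The conditions t h(t) -> oo and
   h(t) = o(ln t / t) give: K decays faster than any power, K(t / a) and K(t / b) differ by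
   a factor t^(o(1)) for all a, b > 0, and K(t - 2 sqrt t) = K(t) (1 + O(ln t / sqrt t)).
   Share out sqrt t / 2 among the indices proportionally to |c_i|^delta and call i a jump when
   |c_i X_i| exceeds its share; all the other indices together contribute at most sqrt t / 2.
   The expected number p of jumps is at most t^-4.  If the sum exceeds t with k jumps, then one
   term exceeds (t - sqrt t) / k and k - 1 other indices jump, which by independence has
   probability O(t^k K(t / k0) p^(k-1)): negligible against K(t / k0) for k >= 2, even summed
   over k.  For k = 1 one term exceeds t - sqrt t, and the weights smaller than k0 are
   negligible; this gives the upper bound.  The lower bound uses the disjoint events that
   c_j X_j exceeds t + O(sqrt t) and no other index jumps.  All the estimates are uniform in
   the length of the partial sums, hence pass to the almost sure limit. *)
Require Import Defs.
From HB Require Import structures.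
From mathcomp Require Import all_boot all_order all_algebra.
From mathcomp Require Import all_classical all_reals all_analysis.
From mathcomp Require Import measurable_realfun zify ring lra.
Set Implicit Arguments.
Unset Strict Implicit.
Unset Printing Implicit Defensive.
Import Order.TTheory GRing.Theory Num.Theory.
Import numFieldNormedType.Exports.
Local Open Scope classical_set_scope.
Local Open Scope ring_scope.

(** * Tails with a slow hazard rate *)

(** The obstacle is uniformity in the number of summands: with [k] jumps the tail is evaluated near
    [t / k], where no asymptotics are available once [k] is of the order of [t]. Hence two regimes:
    for [k] up to [sqrt t] the integrated hazard bound costs at most a factor [t ^ k]; beyond that a
    first-order bound of Markov type suffices, because the reference tail is at least
    [exp (- sqrt t)], which [t ^ k] outweighs. The level [sqrt t] is a compromise: shifting by it
    must change the tail by a vanishing relative amount, even after a loss of [t ^ (1/4)], while a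
    share of it must still make jumps rarer than a high power of [t]. With shares [|c_i| ^ delta],
    the ratio of weight to share keeps a factor [|c_i| ^ (1 - delta)], and a high enough power of it
    is summable again. Errors are measured against the right tail at scale [k0], never against the
    tail of the weight at hand, since the tail of a negative weight may vanish. *)

Definition decay {R : realType} (K : R -> R) := forall A : nat, exists2 x0 : R,
  0 < x0 & forall x y, x0 <= x -> x <= y -> y ^+ A * K y <= x ^+ A * K x.

(** The integrated form of [h(t) = o(ln t / t)]. Being free of [h], it also makes sense for a left
    tail that is eventually zero and so has no hazard rate. *)
Definition slow {R : realType} (K : R -> R) := forall eta : R, 0 < eta ->
  exists2 x0 : R, 1 <= x0 & forall x y, x0 <= x -> x <= y ->
    K x <= K y * expR (eta * (ln y ^+ 2 - ln x ^+ 2)).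

Lemma is_derive_nonincreasing {R : realType} (f df : R -> R) (a : R) :
  (forall x, a <= x -> is_derive x 1 f (df x)) ->
  (forall x, a <= x -> df x <= 0) ->
  forall x y, a <= x -> x <= y -> f y <= f x.
Proof.
move=> fE df0 x y ax xy.
have fd z : z \in `]x, y[ -> is_derive z 1 f (df z).
  by rewrite in_itv/= => /andP[xz _]; apply: fE; apply: le_trans ax (ltW xz).
have fc : {within `[x, y], continuous f}.
  apply: derivable_within_continuous => z; rewrite in_itv/= => /andP[xz _].
  by have := fE z (le_trans ax xz) => -[].
have [z] := MVT_segment xy fd fc.
rewrite in_itv/= => /andP[xz _] fyx; rewrite -subr_le0 fyx.
by rewrite mulr_le0_ge0 ?subr_ge0// df0// (le_trans ax).
Qed.

(** The derivative of [x ^+ A * K x] has the sign of [A - x * h x], which is nonpositive once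
    [x * h x] has passed [A]. *)
Lemma hazard_decay {R : realType} (K h : R -> R) :
  hazard_rate K h -> (t * h t) @[t --> +oo] --> +oo -> decay K.
Proof.
move=> [t0 Kh] /cvgryPge thy A.
have [u [_ uP]] := thy A%:R.
pose x0 := Num.max 1 (Num.max t0 (u + 1)).
have x0P x : x0 <= x -> [/\ 1 <= x, t0 <= x & u < x].
  by rewrite !ge_max => /and3P[? ? ?]; split=> //; lra.
exists x0 => [|x y]; first by rewrite lt_max ltr01.
apply: (@is_derive_nonincreasing R (fun x => x ^+ A * K x)
  (fun x => A%:R * x ^+ A.-1 * K x - x ^+ A * (h x * K x)))
  => {x y} [x /x0P[x1 t0x _]|x /x0P[x1 t0x ux]].
- have [Kx dK] := Kh _ t0x.
  have dK' : is_derive x 1 K (- (h x * K x)).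
    have := is_derive_eq (is_deriveB (@is_derive_cst R R R 1 x 1) dK) (sub0r _).
    by congr (is_derive _ _ _ _); apply/funext => s; rewrite !fctE subKr.
  have dX : is_derive x 1 (fun x => x ^+ A) (A%:R * x ^+ A.-1).
    have := @is_deriveX R R id A x 1 1 (is_derive_id _ _).
    by rewrite exprfctE /GRing.scale/= mulr1.
  apply: (is_derive_eq (is_deriveM dX dK')).
  by rewrite /GRing.scale/=; ring.
- have [Kx _] := Kh _ t0x; rewrite subr_le0.
  have xA := uP _ ux.
  have x0' : 0 < x by lra.
  (* For [A = 0] the truncated exponent [A.-1] gives no information; there [0 <= x * h x] yields
     [0 <= h x] directly. *)
  case: A xA {uP} => [|A] xA; first by rewrite !mul0r expr0 mul1r; apply: mulr_ge0; [rewrite -(pmulr_rge0 _ x0')|exact: ltW].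
  have -> : A.+1%:R * x ^+ A * K x = x ^+ A * K x * A.+1%:R by ring.
  have -> : x ^+ A.+1 * (h x * K x) = x ^+ A * K x * (x * h x) by rewrite exprS; ring.
  by rewrite ler_wpM2l// mulr_ge0 ?exprn_ge0// ltW.
Qed.

(** The function [K x * expR (eta * ln x ^+ 2)] is eventually nondecreasing: the logarithmic
    derivative of the exponential factor is [2 * eta * ln x / x], which exceeds [h x]. *)
Lemma hazard_slow {R : realType} (K h : R -> R) :
  hazard_rate K h -> (h t / (ln t / t)) @[t --> +oo] --> 0 -> slow K.
Proof.
move=> [t0 Kh] /cvgrPdist_le hl eta eta0.
have [u [_ uP]] := hl _ eta0.
pose x0 := Num.max 2 (Num.max t0 (u + 1)).
have x0P x : x0 <= x -> [/\ 2 <= x, t0 <= x & u < x].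
  by rewrite !ge_max => /and3P[? ? ?]; split=> //; lra.
exists x0 => [|x y x0x xy]; first by rewrite le_max ler1n.
suff : - K y * expR (eta * ln y ^+ 2) <= - K x * expR (eta * ln x ^+ 2).
  rewrite !mulNr lerN2 mulrBr expRD expRN mulrA => le.
  by rewrite ler_pdivlMr ?expR_gt0.
move: x y x0x xy.
apply: (@is_derive_nonincreasing R (fun x => - K x * expR (eta * ln x ^+ 2))
  (fun x => K x * expR (eta * ln x ^+ 2) * (h x - eta * 2 * ln x / x)))
  => [x /x0P[x1 t0x _]|x /x0P[x1 t0x ux]].
- have [Kx dK] := Kh _ t0x.
  have dK' : is_derive x 1 (fun x => - K x) (h x * K x).
    have := is_derive_eq (is_deriveB dK (@is_derive_cst R R R 1 x 1)) (subr0 _).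
    by congr (is_derive _ _ _ _); apply/funext => s; rewrite !fctE addrC addKr.
  have dl : is_derive x 1 (@ln R) x^-1 by apply: is_derive1_ln; lra.
  have dl2 : is_derive x 1 (fun x => eta * ln x ^+ 2) (eta * 2 * ln x / x).
    have := is_deriveM (@is_derive_cst R R R eta x 1) (is_deriveX 2 dl).
    by rewrite exprfctE /GRing.scale/= => /is_derive_eq; apply; rewrite expr1 mulr0 addr0; ring.
  have de : is_derive x 1 (fun x => expR (eta * ln x ^+ 2)) (eta * 2 * ln x / x * expR (eta * ln x ^+ 2)).
    have := @is_derive1_comp R expR (fun x => eta * ln x ^+ 2) x _ _ (is_derive_expR _) dl2.
    by rewrite mulrC.
  by apply: (is_derive_eq (is_deriveM dK' de)); rewrite /GRing.scale/=; ring.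
- have [Kx _] := Kh _ t0x.
  rewrite mulr_ge0_le0 ?mulr_ge0 ?expR_ge0 ?(ltW Kx)// subr_le0.
  have lx : 0 < ln x by rewrite ln_gt0; lra.
  have x0' : 0 < x by lra.
  have lx' : 0 < ln x / x by apply: divr_gt0.
  have := uP _ ux; rewrite sub0r normrN => /(le_trans (ler_norm _)).
  rewrite ler_pdivrMr // => /le_trans; apply.
  by rewrite -[leRHS]mulrA -mulrA ler_wpM2l ?(ltW eta0)//; lra.
Qed.

Lemma near_ge {R : realType} (A : R) : \forall t \near +oo, A <= t.
Proof. by apply: nbhs_pinfty_ge; exact: num_real. Qed.

Lemma near_gt {R : realType} (A : R) : \forall t \near +oo, A < t.
Proof. by apply: nbhs_pinfty_gt; exact: num_real. Qed.

Lemma near_ln_ge {R : realType} (A : R) : \forall t \near +oo, A <= ln t.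
Proof.
near=> t; rewrite -ler_expR lnK ?posrE; near: t.
  exact: near_ge.
exact: near_gt.
Unshelve. all: by end_near. Qed.

Lemma sqrtr_expR {R : realType} (t : R) : 0 < t -> Num.sqrt t = expR (ln t / 2).
Proof.
move=> t0; rewrite -[X in Num.sqrt X](lnK t0) [X in expR X]splitr expRD -expr2.
by rewrite sqrtr_sqr ger0_norm ?expR_ge0.
Qed.

Lemma expR_le1D2x {R : realType} (y : R) : 0 <= y <= 2^-1 -> expR y <= 1 + 2 * y.
Proof.
move=> /andP[y0 y1]; have := expR_ge1Dx (- y); rewrite expRN => h.
have e0 := expR_gt0 y.
have : (1 - y) * expR y <= 1 by rewrite -ler_pdivlMr// mul1r.
nra.
Qed.

Lemma expR_ge_cubic {R : realType} (x : R) : 0 <= x -> x ^+ 3 / 6 <= expR x.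
Proof.
move=> x0; have := expR_ge1Dxn 2 x0.
have -> : 3`!%:R = 6 :> R by [].
lra.
Qed.

Lemma slow_ratio {R : realType} (K : R -> R) (a b eta : R) :
  (forall x, 0 <= K x) -> (forall x y, x <= y -> K y <= K x) -> slow K ->
  0 < a -> 0 < b -> 0 < eta ->
  \forall t \near +oo, K (t / a) <= expR (eta * ln t) * K (t / b).
Proof.
move=> K0 Kn Ks a0 b0 eta0; have [ab|ba] := leP a b.
  near=> t.
  have t0 : 0 <= t by near: t; exact: near_ge.
  apply: (@le_trans _ _ (K (t / b))).
    by apply: Kn; rewrite ler_wpM2l// lef_pV2 ?posrE.
  rewrite ler_peMl// -expR0 ler_expR mulr_ge0 ?(ltW eta0)//.
  by near: t; exact: near_ln_ge.
have D0 : 0 < ln a - ln b by rewrite subr_gt0 ltr_ln ?posrE.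
(* The squared logarithms at [t / b] and [t / a] differ by
   [(ln a - ln b) * (2 * ln t - ln a - ln b)], at most [3 * (ln a - ln b) * ln t] for large [t];
   this dictates the choice of rate. *)
have /Ks[x0 x01 Kx0] : 0 < eta / (3 * (ln a - ln b)) by rewrite divr_gt0// mulr_gt0.
near=> t.
have t0 : 0 < t by near: t; exact: near_gt.
have lt : - (ln a + ln b) <= ln t by near: t; exact: near_ln_ge.
have xt : x0 <= t / a.
  by rewrite ler_pdivlMr//; near: t; exact: near_ge.
have tab : t / a <= t / b.
  by rewrite ler_wpM2l ?ltW// ltf_pV2 ?posrE.
apply: le_trans (Kx0 _ _ xt tab) _; rewrite mulrC ler_wpM2r// ler_expR.
rewrite !ln_div ?posrE//.
rewrite mulrAC ler_pdivrMr ?mulr_gt0//.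
rewrite -!mulrA ler_wpM2l ?(ltW eta0)//.
have := ler_wpM2l (ltW D0) lt; lra.
Unshelve. all: by end_near. Qed.

Lemma near_sqrt_ge_ln {R : realType} (A : R) : 0 < A ->
  \forall t \near +oo, A * ln t <= Num.sqrt t.
Proof.
move=> A0; near=> t.
have t0 : 0 < t by near: t; exact: near_gt.
have l0 : 0 <= ln t by near: t; exact: near_ln_ge.
have lA : 8 * A <= ln t by near: t; exact: near_ln_ge.
have l2 : 0 <= ln t / 2 by rewrite divr_ge0.
rewrite sqrtr_expR//; apply: le_trans (expR_ge1Dxn 1 l2).
rewrite (_ : 2`!%:R = 2 :> R)//; have := ler_wpM2l l0 lA; clear; lra.
Unshelve. all: by end_near. Qed.

(** Here [s] is the square root of [t]. Factor the difference of squares: the two logarithms differ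
    by at most [4 / s] and their sum is at most [4 * ln t]. *)
Lemma ln_sqr_shift {R : realType} (t s a x0 : R) :
  t = s ^+ 2 -> 8 <= s -> 0 < a -> 1 <= x0 -> 2 * x0 * a <= t -> - ln a <= ln t ->
  [/\ x0 <= (t - 2 * s) / a, (t - 2 * s) / a <= t / a &
    0 <= ln (t / a) ^+ 2 - ln ((t - 2 * s) / a) ^+ 2 <= 16 * ln t / s].
Proof.
move=> ts s8 a0 x01 tx la.
have s0 : 0 < s by lra.
have t0 : 0 < t by rewrite ts exprn_gt0.
have ts2 : t / 2 <= t - 2 * s by rewrite ts; nra.
have t2s0 : 0 < t - 2 * s by lra.
have xq : x0 <= (t - 2 * s) / a by rewrite ler_pdivlMr//; lra.
have qp : (t - 2 * s) / a <= t / a by rewrite ler_pM2r ?invr_gt0//; lra.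
split => //.
have q0 : 0 <= ln ((t - 2 * s) / a) by rewrite ln_ge0// (le_trans x01).
have pq : ln (t / a) - ln ((t - 2 * s) / a) <= 4 / s.
  rewrite !ln_div ?posrE//.
  have -> : ln t - ln a - (ln (t - 2 * s) - ln a) = ln t - ln (t - 2 * s) by ring.
  rewrite -ln_div ?posrE//.
  have -> : t / (t - 2 * s) = 1 + 2 * s / (t - 2 * s) by field; rewrite gt_eqF.
  have y0 : 0 <= 2 * s / (t - 2 * s) by rewrite divr_ge0 ?mulr_ge0// ltW.
  apply: (le_trans (le_ln1Dx (lt_le_trans (ltrN10 _) y0))).
  by rewrite ler_pdivrMr// mulrAC ler_pdivlMr// ts; nra.
have pl : ln (t / a) <= 2 * ln t by rewrite ln_div ?posrE//; lra.
have qp' : ln ((t - 2 * s) / a) <= ln (t / a) by rewrite ler_ln ?posrE ?divr_gt0.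
rewrite subr_sqr; move: (ln (t / a)) (ln ((t - 2 * s) / a)) q0 pq pl qp' => p q q0 pq pl qp'.
rewrite mulr_ge0/= ?subr_ge0 ?addr_ge0 ?(le_trans q0)//.
have -> : 16 * ln t / s = 4 / s * (4 * ln t) by ring.
by apply: ler_pM; rewrite ?subr_ge0 ?addr_ge0 ?(le_trans q0)//; lra.
Qed.

(** The shift costs [K (t / a)] a relative error of order [ln t / sqrt t]. Passing to the reference
    [Kp (t / b)] loses a factor [t ^ (1/4)], so the total error is still [o(Kp (t / b))]. *)
Lemma slow_shift {R : realType} (K Kp : R -> R) (C a b eps : R) :
  (forall x, 0 <= K x) -> slow K ->
  (forall x, 0 <= Kp x) -> (forall x y, x <= y -> Kp y <= Kp x) -> slow Kp ->
  0 < C -> (\forall t \near +oo, K t <= C * Kp t) ->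
  0 < a -> 0 < b -> 0 < eps ->
  \forall t \near +oo, K ((t - 2 * Num.sqrt t) / a) <= K (t / a) + eps * Kp (t / b).
Proof.
move=> K0 Ks Kp0 Kpn Kps C0 [u [_ KC]] a0 b0 eps0.
have [x0 x01 Kx0] := Ks 1 ltr01.
have r4 : 0 < 4^-1 :> R by rewrite invr_gt0.
near=> t.
have t0 : 0 < t by near: t; exact: near_gt.
have l16 : 16 <= ln t by near: t; exact: near_ln_ge.
(* From [exp x >= x ^ 2 / 2] at [x = ln t / 4] one gets [t ^ (1/4) >= (ln t) ^ 2 / 32]; then
   [32 * C * ln t <= eps * t ^ (1/4)] as soon as [ln t >= 32 * 32 * C / eps]. *)
have lC : 1024 * C / eps <= ln t by near: t; exact: near_ln_ge.
have la : - ln a <= ln t by near: t; exact: near_ln_ge.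
have tx : 2 * x0 * a <= t by near: t; exact: near_ge.
have tu : u < t / a.
  by rewrite ltr_pdivlMr//; near: t; exact: near_gt.
have s32 : 32 * ln t <= Num.sqrt t by near: t; exact: near_sqrt_ge_ln.
have KCa : K (t / a) <= C * (expR (4^-1 * ln t) * Kp (t / b)).
  apply: (le_trans (KC _ tu)); rewrite ler_wpM2l ?(ltW C0)//.
  by near: t; exact: slow_ratio.
have s8 : 8 <= Num.sqrt t by apply: le_trans s32; clear -l16; lra.
have s0 : 0 < Num.sqrt t by apply: lt_le_trans s8.
have l0 : 0 <= ln t by apply: le_trans l16.
have ts : t = Num.sqrt t ^+ 2 by rewrite sqr_sqrtr// ltW.
have [xq qp /andP[E0 E1]] := ln_sqr_shift ts s8 a0 x01 tx la.
apply: (le_trans (Kx0 _ _ xq qp)); rewrite mul1r.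
apply: (@le_trans _ _ (K (t / a) * (1 + 2 * (16 * ln t / Num.sqrt t)))).
  rewrite ler_wpM2l// (le_trans (expR_le1D2x _))//; last by rewrite lerD2l ler_wpM2l.
  rewrite E0 (le_trans E1)// ler_pdivrMr// ler_pdivlMl// mulrA.
  by apply: le_trans s32; clear; lra.
rewrite mulrDr mulr1 lerD2l.
apply: (le_trans (ler_wpM2r _ KCa)).
  by rewrite mulr_ge0// divr_ge0 ?mulr_ge0// ltW.
have e0 : 0 < expR (4^-1 * ln t) by exact: expR_gt0.
have sE : Num.sqrt t = expR (4^-1 * ln t) * expR (4^-1 * ln t).
  by rewrite sqrtr_expR// -expRD; congr expR; field.
rewrite sE (_ : C * _ * _ = 32 * ln t * C / expR (4^-1 * ln t) * Kp (t / b)); last first.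
  by field; rewrite gt_eqF.
rewrite ler_wpM2r// ler_pdivrMr//.
have e32 : ln t * (ln t / 32) <= expR (4^-1 * ln t).
  have l4 : 0 <= 4^-1 * ln t by rewrite mulr_ge0// ltW.
  apply: le_trans (expR_ge1Dxn 1 l4); rewrite (_ : 2`!%:R = 2 :> R)//.
  by clear; lra.
rewrite -ler_pdivrMl//; apply: le_trans e32.
rewrite (_ : eps^-1 * _ = ln t * (1024 * C / eps / 32)).
  by rewrite ler_wpM2l// ler_wpM2r.
by field; rewrite gt_eqF.
Unshelve. all: by end_near. Qed.

(** Apply the left shift at [t' = t + 2 * sqrt t], for which [t' - 2 * sqrt t' <= t]. *)
Lemma slow_shift_right {R : realType} (K Kp : R -> R) (C a b eps : R) :
  (forall x, 0 <= K x) -> (forall x y, x <= y -> K y <= K x) -> slow K ->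
  (forall x, 0 <= Kp x) -> (forall x y, x <= y -> Kp y <= Kp x) -> slow Kp ->
  0 < C -> (\forall t \near +oo, K t <= C * Kp t) ->
  0 < a -> 0 < b -> 0 < eps ->
  \forall t \near +oo, K (t / a) <= K ((t + 2 * Num.sqrt t) / a) + eps * Kp (t / b).
Proof.
move=> K0 Kn Ks Kp0 Kpn Kps C0 KC a0 b0 eps0.
have [u [_ uP]] := slow_shift K0 Ks Kp0 Kpn Kps C0 KC a0 b0 eps0.
near=> t.
have t0 : 0 < t by near: t; exact: near_gt.
have s0 : 0 < Num.sqrt t by rewrite sqrtr_gt0.
have ut : u < t + 2 * Num.sqrt t.
  have : u < t by near: t; exact: near_gt.
  lra.
have st : Num.sqrt t <= Num.sqrt (t + 2 * Num.sqrt t) by rewrite ler_sqrt; lra.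
apply: (@le_trans _ _ (K ((t + 2 * Num.sqrt t - 2 * Num.sqrt (t + 2 * Num.sqrt t)) / a))).
  by apply: Kn; rewrite ler_pM2r ?invr_gt0//; lra.
apply: (le_trans (uP _ ut)); rewrite lerD2l ler_wpM2l ?(ltW eps0)//.
by apply: Kpn; rewrite ler_pM2r ?invr_gt0//; lra.
Unshelve. all: by end_near. Qed.

(** Put [q] strictly between [a] and [b]. Eventually [(t - sqrt t) / a] exceeds [t / q], and decay
    of order [A] gains the factor [(q / b) ^+ A], made at most [eps] by the choice of [A]. *)
Lemma decay_negligible {R : realType} (Kp : R -> R) (a b eps : R) :
  (forall x, 0 <= Kp x) -> (forall x y, x <= y -> Kp y <= Kp x) -> decay Kp ->
  0 < a -> a < b -> 0 < eps ->
  \forall t \near +oo, Kp ((t - Num.sqrt t) / a) <= eps * Kp (t / b).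
Proof.
move=> Kp0 Kpn Kd a0 ab eps0.
have [q aq qb] : exists2 q, a < q & q < b by exists ((a + b) / 2); lra.
have [A qA] : exists A, (q / b) ^+ A <= eps.
  have qb1 : `|q / b| < 1.
    by rewrite ger0_norm ?divr_ge0 ?ltr_pdivrMr ?mul1r//; lra.
  have /cvgrPdist_le/(_ _ eps0)[A _ /(_ A (leqnn A))] := cvg_expr qb1.
  by rewrite sub0r normrN => /(le_trans (ler_norm _)) ?; exists A.
have [x0 x00 x0P] := Kd A.
near=> t.
have t0 : 0 < t by near: t; exact: near_gt.
have tx : x0 * b <= t by near: t; exact: near_ge.
have tq : (q / (q - a)) ^+ 2 <= t by near: t; exact: near_ge.
have tt : t / q <= (t - Num.sqrt t) / a.
  have sq : q / (q - a) <= Num.sqrt t.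
    by rewrite -(ger0_norm (_ : 0 <= q / (q - a))) ?divr_ge0 -?sqrtr_sqr ?ler_sqrt//; lra.
  rewrite ler_pdivrMr ?(lt_trans a0)// mulrAC ler_pdivlMr//.
  move: sq; rewrite ler_pdivrMr ?subr_gt0// => sq.
  have ss : Num.sqrt t ^+ 2 = t by rewrite sqr_sqrtr// ltW.
  have s0 : 0 < Num.sqrt t by rewrite sqrtr_gt0.
  have := ler_wpM2l (ltW s0) sq; nra.
have q0 : 0 < q := lt_trans a0 aq.
have b0 : 0 < b := lt_trans q0 qb.
apply: (le_trans (Kpn _ _ tt)).
have xb : x0 <= t / b by rewrite ler_pdivlMr.
have bq : t / b <= t / q by rewrite ler_pM2l// lef_pV2 ?posrE// ltW.
have := x0P _ _ xb bq.
have -> : (t / b) ^+ A = (t / q) ^+ A * (q / b) ^+ A.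
  by rewrite -exprMn; congr (_ ^+ _); field; rewrite !gt_eqF.
rewrite -[in leRHS]mulrA ler_pM2l ?exprn_gt0 ?divr_gt0// => /le_trans; apply.
by rewrite ler_wpM2r.
Unshelve. all: by end_near. Qed.

(** A slow tail is bounded below by a constant times [exp (- (ln x) ^ 2)], much larger than
    [exp (- sqrt t)]. *)
Lemma slow_lower {R : realType} (K : R -> R) (b : R) :
  (forall x, 0 < K x) -> slow K -> 0 < b ->
  \forall t \near +oo, expR (- Num.sqrt t) <= K (t / b).
Proof.
move=> K0 Ks b0; have [x0 x01 Kx0] := Ks 1 ltr01.
near=> t.
have t0 : 0 < t by near: t; exact: near_gt.
(* With [l = ln t], the cubic bound gives [sqrt t >= l ^ 3 / 48], hence at least [5 * l ^ 2] when
   [l >= 240]. Four of these five squares pay for [ln (t / b) ^+ 2], the fifth for [- ln (K x0)]. *)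
have L1 : 240 <= ln t by near: t; exact: near_ln_ge.
have L2 : - ln b <= ln t by near: t; exact: near_ln_ge.
have L3 : - ln (K x0) <= ln t by near: t; exact: near_ln_ge.
have tx : x0 * b <= t by near: t; exact: near_ge.
have xb : x0 <= t / b by rewrite ler_pdivlMr.
have := Kx0 _ _ (lexx _) xb.
rewrite mul1r -ler_pdivrMr ?expR_gt0// -expRN => /(le_trans _); apply.
rewrite -{1}(lnK (K0 x0)) -expRD ler_expR (sqrtr_expR t0).
set l := ln t in L1 L2 L3 *.
have l2 : 0 <= l / 2 by lra.
have := expR_ge_cubic l2.
have lb0 : 0 <= ln (t / b) by rewrite ln_ge0//; lra.
have lb : ln (t / b) <= 2 * l by rewrite ln_div ?posrE// -/l; lra.
have lb2 : ln (t / b) ^+ 2 <= 4 * l ^+ 2 by nra.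
have lx := sqr_ge0 (ln x0).
have l3 : 240 * l ^+ 2 <= l ^+ 3 by rewrite (exprS l 2) ler_wpM2r ?sqr_ge0.
have -> : (l / 2) ^+ 3 / 6 = l ^+ 3 / 48 by field.
have : l <= l ^+ 2 by rewrite expr2; nra.
lra.
Unshelve. all: by end_near. Qed.

Lemma expR_natr {R : realType} (t : R) k : 0 < t -> t ^+ k = expR (k%:R * ln t).
Proof. by move=> t0; rewrite -[in LHS](lnK t0) -expRM_natl mulr_natl. Qed.

(* A sum of [k] terms exceeds [t] only if one exceeds about [t / k]; this costs
   at most the factor [t ^ k], uniformly in [k], against the reference tail. *)
Lemma slow_div_le {R : realType} (K : R -> R) (a b C s0 : R) :
  (forall x, 0 < K x) -> (forall x y, x <= y -> K y <= K x) -> slow K ->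
  0 < a -> 0 < b -> 0 < C ->
  \forall t \near +oo, forall k v, (0 < k)%N ->
    v <= C * k%:R / (t - Num.sqrt t) ->
    (s0 <= (t - Num.sqrt t) / k%:R -> v <= C * K ((t - Num.sqrt t) / k%:R / a)) ->
    v <= C * (t ^+ k * K (t / b)).
Proof.
move=> K0 Kn Ks a0 b0 C0.
pose c0 := `|ln a - ln b|.
have c00 : 0 <= c0 by exact: normr_ge0.
(* The logarithms of [t / b] and [t / (2 * k * a)] differ by at most [(2 + c0) * k] and sum to at
   most [3 * ln t]; this rate turns the product into [k * ln t], that is, into the factor
   [t ^+ k]. *)
have eta0 : 0 < (3 * (2 + c0))^-1 by rewrite invr_gt0; lra.
have [x0 x01 Kx0] := Ks _ eta0.
near=> t => k v k0 vC vK.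
have t0 : 0 < t by near: t; exact: near_gt.
have t16 : 16 <= t by near: t; exact: near_ge.
have L2 : 2 <= ln t by near: t; exact: near_ln_ge.
have Lb : - 2 * ln b <= ln t by near: t; exact: near_ln_ge.
have tx : (2 * s0) ^+ 2 <= t by near: t; exact: near_ge.
have txa : (2 * x0 * a) ^+ 2 <= t by near: t; exact: near_ge.
have s1 : 0 < Num.sqrt t by rewrite sqrtr_gt0.
have le_s (y : R) : y ^+ 2 <= t -> y <= Num.sqrt t.
  by move=> yt; rewrite (le_trans (ler_norm _))// -sqrtr_sqr ler_sqrt// ltW.
have s4 : 4 <= Num.sqrt t by apply: le_s; lra.
have st : Num.sqrt t ^+ 2 = t by rewrite sqr_sqrtr// ltW.
have slow_t : expR (- Num.sqrt t) <= K (t / b) by near: t; exact: slow_lower.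
set s := Num.sqrt t in vC vK s1 le_s s4 st slow_t *.
have ts : t / 2 <= t - s by rewrite -st; nra.
have kR : 1 <= k%:R :> R by rewrite ler1n.
have Kb := K0 (t / b).
(* If [k <= sqrt t], the argument [(t - s) / k] is at least [s / 2], so the tail bound applies.
   Otherwise [t ^+ k >= exp (2 * k) >= k * exp s], so [t ^+ k * K (t / b) >= k] and the crude bound
   is enough. *)
have [ks|sk] := leP k%:R s.
  have xk : t / (2 * k%:R) <= (t - s) / k%:R.
    by rewrite invfM mulrA ler_pM2r ?invr_gt0//; lra.
  have sx : s / 2 <= t / (2 * k%:R).
    by rewrite invfM mulrA ler_pdivlMr ?(lt_le_trans ltr01)// -[in leRHS]st; nra.
  apply: (le_trans (vK _)).
    by have := le_s _ tx; clear -xk sx; lra.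
  rewrite ler_wpM2l ?(ltW C0)//.
  apply: (@le_trans _ _ (K (t / (2 * k%:R) / a))).
    by apply: Kn; rewrite ler_pM2r ?invr_gt0.
  have xa : x0 <= t / (2 * k%:R) / a.
    by rewrite ler_pdivlMr//; have := le_s _ txa; clear -sx; lra.
  have tk1 : 1 <= t ^+ k by rewrite exprn_ege1//; lra.
  have [tba|tab] := leP (t / b) (t / (2 * k%:R) / a).
    by apply: (le_trans (Kn _ _ tba)); rewrite ler_peMl// ltW.
  apply: (le_trans (Kx0 _ _ xa (ltW tab))); rewrite mulrC ler_pM2r//.
  rewrite (expR_natr k t0) ler_expR ler_pdivrMl; last by clear -c00; lra.
  have k00 : 0 < k%:R :> R by exact: lt_le_trans kR.
  rewrite !ln_div ?posrE ?divr_gt0 ?mulr_gt0// lnM ?posrE//.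
  have lk : ln 2 + ln k%:R <= 2 * k%:R :> R.
    rewrite -lnM ?posrE//; apply: (le_trans (ltW (ln_sublinear _))) => //.
    by rewrite mulr_gt0.
  have := ler_norm (ln a - ln b); rewrite -/c0 => cab.
  have xa1 : 0 <= ln (t / (2 * k%:R) / a) by rewrite ln_ge0// (le_trans x01).
  have D0 : ln (t / (2 * k%:R) / a) <= ln (t / b).
    by rewrite ler_ln ?posrE ?divr_gt0 ?mulr_gt0// ltW.
  rewrite !ln_div ?posrE ?divr_gt0 ?mulr_gt0// lnM ?posrE// in xa1 D0.
  set l := ln t in L2 Lb xa1 D0 *; set lk' := ln 2 + ln k%:R in lk xa1 D0 *.
  rewrite subr_sqr.
  have -> : 3 * (2 + c0) * (k%:R * l) = ((2 + c0) * k%:R) * (3 * l) by ring.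
  apply: ler_pM; [clear -D0; lra|clear -xa1 D0; lra| |clear -D0 Lb; lra].
  by clear -c00 cab lk kR; nra.
apply: (le_trans vC).
have kt0 : k%:R * expR s <= t ^+ k.
  rewrite expR_natr//; apply: (@le_trans _ _ (expR k%:R * expR k%:R)).
    apply: ler_pM; rewrite ?expR_ge0 ?ler0n ?ler_expR ?(ltW sk)//.
    by apply: le_trans (expR_ge1Dx _); rewrite lerDr.
  rewrite -expRD ler_expR (_ : k%:R + k%:R = k%:R * 2); last by ring.
  by rewrite ler_wpM2l// ler0n.
rewrite -mulrA ler_wpM2l ?(ltW C0)//.
apply: (@le_trans _ _ (t ^+ k * expR (- s))).
  rewrite expRN ler_pdivlMr ?expR_gt0// (le_trans _ kt0)//.
  rewrite ler_wpM2r ?expR_ge0// ler_pdivrMr; last by clear -ts t16; lra.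
  by rewrite ler_peMr//; clear -ts t16; lra.
by rewrite ler_wpM2l// exprn_ge0// ltW.
Unshelve. all: by end_near. Qed.

(** * Weighted tails dominated by one reference tail *)

Definition dominated {R : realType} (M : R -> R -> R) (K : R -> R) :=
  [/\ forall c x, 0 <= M c x <= 1,
      forall x, 0 <= x -> M 0 x = 0 &
      exists C x1, 0 < C /\
        forall c x, c != 0 -> x1 <= x / `|c| -> M c x <= C * K (x / `|c|)].

(** A Markov inequality of every order, uniform in the weight, with decay in place of moments. Below
    the threshold on [x / |c|] the bound [M <= 1] suffices, at the price of a larger constant. *)
Lemma dominated_poly {R : realType} (M : R -> R -> R) (K : R -> R) :
  (forall x, 0 < K x) -> decay K -> dominated M K ->
  forall N, exists2 C, 0 < C &
    forall c x, 0 < x -> M c x <= C * (`|c| / x) ^+ N.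
Proof.
move=> K0 Kd [M01 M0 [C [x1 [C0 MK]]]] N.
have [x0 x00 x0P] := Kd N.
pose y0 := Num.max x0 x1.
have y00 : 0 < y0 by rewrite lt_max x00.
exists (y0 ^+ N * (1 + C * K y0)) => [|c x x_gt0].
  by rewrite mulr_gt0 ?exprn_gt0// addr_gt0// mulr_gt0.
have [->|c0] := eqVneq c 0.
  rewrite M0 ?(ltW x_gt0)// !mulr_ge0 ?exprn_ge0 ?divr_ge0 ?(ltW x_gt0) ?(ltW y00)//.
  by rewrite addr_ge0 ?mulr_ge0 ?ltW.
have c0' : 0 < `|c| by rewrite normr_gt0.
pose y := x / `|c|.
have y_gt0 : 0 < y by rewrite divr_gt0.
have -> : `|c| / x = y^-1 by rewrite invf_div.
rewrite exprVn ler_pdivlMr ?exprn_gt0//.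
have [y0y|yy0] := leP y0 y.
  have x1y : x1 <= y by apply: le_trans y0y; rewrite le_max lexx orbT.
  apply: (@le_trans _ _ (C * K y * y ^+ N)).
    by rewrite ler_wpM2r ?exprn_ge0 ?(ltW y_gt0)// MK.
  have x0y0 : x0 <= y0 by rewrite le_max lexx.
  have h := x0P _ _ x0y0 y0y.
  have yN : 0 <= y0 ^+ N by rewrite exprn_ge0// ltW.
  have := ler_wpM2l (ltW C0) h; nra.
have /andP[_ M1] := M01 c x.
apply: (@le_trans _ _ (1 * y0 ^+ N)).
  apply: ler_pM => //; first by case/andP: (M01 c x).
    by rewrite exprn_ge0// ltW.
  by apply: lerXn2r; rewrite ?nnegrE ?ltW.
rewrite mulrC ler_wpM2l ?exprn_ge0 ?(ltW y00)// lerDl.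
by rewrite mulr_ge0 ?ltW.
Qed.

(** Decay of order one gives [K (x / |c_i|) <= |c_i| / a * K (x / a)], and the extra factor [|c_i|]
    makes the sum bounded whatever its length. *)
Lemma dominated_sum {R : realType} (M : R -> R -> R) (K : R -> R) (a B : R) :
  (forall x, 0 < K x) -> decay K -> dominated M K -> 0 < a -> 0 < B ->
  exists C s0, 0 < C /\ forall x, s0 <= x ->
    forall (I : Type) (r : seq I) (P : pred I) (c : I -> R),
      (forall i, P i -> `|c i| <= a) -> \sum_(i <- r | P i) `|c i| <= B ->
      \sum_(i <- r | P i) M (c i) x <= C * K (x / a).
Proof.
move=> K0 Kd [M01 M0 [C [x1 [C0 MK]]]] a0 B0.
have [x0 x00 x0P] := Kd 1%N.
exists (C * B / a), (a * Num.max x0 x1); split => [|x].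
  by rewrite divr_gt0// mulr_gt0.
rewrite mulrC -ler_pdivlMr// ge_max => /andP[x0x x1x] I r P c ca cB.
have x_gt0 : 0 < x by rewrite -(pmulr_lgt0 x (x := a^-1)) ?invr_gt0// (lt_le_trans x00).
apply: (@le_trans _ _ (\sum_(i <- r | P i) `|c i| * (C / a * K (x / a)))).
  apply: ler_sum => i Pi; have [ci0|ci0] := eqVneq (c i) 0.
    by rewrite ci0 M0 ?(ltW x_gt0)// normr0 mul0r.
  have ci0' : 0 < `|c i| by rewrite normr_gt0.
  have xaci : x / a <= x / `|c i| by rewrite ler_pM2l// lef_pV2 ?posrE// ca.
  apply: (le_trans (MK _ _ ci0 (le_trans x1x xaci))).
  have -> : `|c i| * (C / a * K (x / a)) = C * (`|c i| / a * K (x / a)) by ring.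
  rewrite ler_wpM2l ?(ltW C0)//.
  have xa0 : 0 < x / a by rewrite divr_gt0.
  have -> : `|c i| / a = (x / a) / (x / `|c i|).
    by field; rewrite ?normr_eq0 ?ci0 ?gt_eqF.
  rewrite mulrAC ler_pdivlMr ?divr_gt0// mulrC.
  by have := x0P _ _ x0x xaci; rewrite !expr1.
rewrite -mulr_suml (_ : C * B / a * K (x / a) = B * (C / a * K (x / a))); last by ring.
by rewrite ler_wpM2r// !mulr_ge0 ?invr_ge0 ?ltW.
Qed.

Lemma powR_le_scale {R : realType} (x a p q : R) :
  0 < p <= q -> 0 <= x <= a -> x `^ q <= a `^ (q - p) * x `^ p.
Proof.
move=> /andP[p0 pq] /andP[x0 xa].
have q0 : 0 < q by apply: lt_le_trans pq.
move: x0; rewrite le_eqVlt => /predU1P[<-|x0].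
  by rewrite !powR0 ?gt_eqF// mulr0.
rewrite -{1}(subrK p q) [leLHS]powRD ?(gt_eqF x0) ?implybT//.
rewrite ler_wpM2r ?powR_ge0// ge0_ler_powR ?subr_ge0// nnegrE ltW//.
exact: lt_le_trans xa.
Qed.

(** The Markov bound of order [2 * N] at [theta i] is a constant times
    [|c_i| ^ ((1 - delta) * 2 * N) * t ^- N]. For large [N] the exponent of [|c_i|] is at least
    [delta], so the sum is controlled by [B]. *)
Lemma dominated_jump {R : realType} (M : R -> R -> R) (K : R -> R) (a B delta : R) :
  (forall x, 0 < K x) -> decay K -> dominated M K -> 0 < a -> 0 < B ->
  0 < delta < 1 ->
  \forall t \near +oo, forall (I : Type) (r : seq I) (c theta : I -> R),
    (forall i, `|c i| <= a) -> \sum_(i <- r) `|c i| `^ delta <= B ->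
    (forall i, theta i = `|c i| `^ delta * (Num.sqrt t / (2 * B))) ->
    \sum_(i <- r) (M (c i) (theta i) + M (- c i) (theta i)) <= t ^- 4.
Proof.
move=> K0 Kd Md a0 B0 /andP[d0 d1].
have [M01 M0 _] := Md.
have [N' N'P] : exists N' : nat, delta <= (1 - delta) * N'%:R.
  exists (Num.truncn (delta / (1 - delta))).+1.
  rewrite mulrC -ler_pdivrMr ?subr_gt0// ltW// truncnS_gt//.
(* [N'] provides summability; the summand 5 leaves [t ^- 5], one power of which absorbs the constant
   [D]. *)
pose N := (N' + 5)%N.
have NP : delta <= (1 - delta) * (2 * N)%:R.
  apply: (le_trans N'P); rewrite ler_wpM2l ?subr_ge0 ?(ltW d1)// ler_nat.
  by rewrite /N mul2n -addnn -addnA leq_addr.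
have [C C0 MC] := dominated_poly K0 Kd Md (2 * N).
pose D := 2 * C * (2 * B) ^+ (2 * N) * a `^ ((1 - delta) * (2 * N)%:R - delta) * B.
near=> t => I r c theta ca cB thetaE.
have t0 : 0 < t by near: t; exact: near_gt.
have t1 : 1 <= t by near: t; exact: near_ge.
have tD : D <= t by near: t; exact: near_ge.
have s0 : 0 < Num.sqrt t by rewrite sqrtr_gt0.
have st : Num.sqrt t ^+ 2 = t by rewrite sqr_sqrtr// ltW.
pose E := 2 * C * (2 * B) ^+ (2 * N) * a `^ ((1 - delta) * (2 * N)%:R - delta) / t ^+ N.
have tN : 0 < t ^+ N by rewrite exprn_gt0.
have E0 : 0 <= E.
  rewrite divr_ge0 ?(ltW tN)// mulr_ge0 ?powR_ge0// mulr_ge0 ?exprn_ge0//.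
    by rewrite mulr_ge0 ?(ltW C0).
  by rewrite mulr_ge0 ?(ltW B0).
apply: (@le_trans _ _ (\sum_(i <- r) `|c i| `^ delta * E)).
  apply: ler_sum => i _; have [ci0|ci0] := eqVneq (c i) 0.
    by rewrite !thetaE ci0 oppr0 normr0 powR0 ?(gt_eqF d0)// !mul0r M0// addr0 lexx.
  have c0 : 0 < `|c i| by rewrite normr_gt0.
  have th0 : 0 < theta i by rewrite thetaE mulr_gt0 ?powR_gt0// divr_gt0// mulr_gt0.
  have -> : `|c i| `^ delta * E = 2 * (C * ((2 * B) ^+ (2 * N) / t ^+ N *
      (a `^ ((1 - delta) * (2 * N)%:R - delta) * `|c i| `^ delta))) by rewrite /E; ring.
  suff h : (`|c i| / theta i) ^+ (2 * N) <= (2 * B) ^+ (2 * N) / t ^+ N *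
      (a `^ ((1 - delta) * (2 * N)%:R - delta) * `|c i| `^ delta).
    have h1 := MC (c i) _ th0; have h2 := MC (- c i) _ th0.
    rewrite normrN in h2.
    have := ler_wpM2l (ltW C0) h; lra.
  have -> : `|c i| / theta i = `|c i| `^ (1 - delta) * (2 * B / Num.sqrt t).
    rewrite powRB ?(gt_eqF c0) ?implybT// powRr1// thetaE.
    by field; rewrite !gt_eqF ?powR_gt0.
  rewrite exprMn expr_div_n [Num.sqrt t ^+ _]exprM st mulrC ler_wpM2l//.
    by rewrite divr_ge0 ?(ltW tN)// exprn_ge0// mulr_ge0 ?(ltW B0).
  by rewrite -powR_mulrn ?powR_ge0// -powRrM powR_le_scale ?d0 ?ca ?normr_ge0.
rewrite -mulr_suml (le_trans (ler_wpM2r E0 cB))//.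
have -> : B * E = D / t ^+ N by rewrite /E /D; ring.
rewrite ler_pdivrMr// (le_trans tD)//.
rewrite ler_pdivlMl ?exprn_gt0// -exprSr ler_weXn2l//.
by rewrite /N leq_addl.
Unshelve. all: by end_near. Qed.

(** * Counting jumps of independent variables *)

Definition pr {R : realType} {d} {T : measurableType d} (P : probability T R)
  (A : set T) : R := fine (P A).

Lemma prE {R : realType} {d} {T : measurableType d} (P : probability T R)
  (A : set T) : measurable A -> P A = (pr P A)%:E.
Proof. by move=> mA; rewrite /pr fineK// fin_num_measure. Qed.

Lemma pr_ge0 {R : realType} {d} {T : measurableType d} (P : probability T R)
  (A : set T) : 0 <= pr P A.
Proof. exact: fine_ge0. Qed.

Lemma pr_le1 {R : realType} {d} {T : measurableType d} (P : probability T R)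
  (A : set T) : measurable A -> pr P A <= 1.
Proof. by move=> mA; rewrite -lee_fin -prE// probability_le1. Qed.

Lemma le_pr {R : realType} {d} {T : measurableType d} (P : probability T R)
  (A B : set T) : measurable A -> measurable B -> A `<=` B -> pr P A <= pr P B.
Proof. by move=> mA mB AB; rewrite -lee_fin -!prE// le_measure ?inE. Qed.

Lemma prU_le {R : realType} {d} {T : measurableType d} (P : probability T R)
  (A B : set T) : measurable A -> measurable B -> pr P (A `|` B) <= pr P A + pr P B.
Proof.
move=> mA mB; rewrite -lee_fin EFinD -!prE//; last exact: measurableU.
exact: measureU2.
Qed.

Lemma prC {R : realType} {d} {T : measurableType d} (P : probability T R)
  (A : set T) : measurable A -> pr P (~` A) = 1 - pr P A.
Proof.
move=> mA; apply: EFin_inj; rewrite -prE; last exact: measurableC.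
by rewrite probability_setC// EFinB -prE.
Qed.

Lemma prD_ge {R : realType} {d} {T : measurableType d} (P : probability T R)
  (A B : set T) : measurable A -> measurable B ->
  pr P A - pr P (A `&` B) <= pr P (A `\` B).
Proof.
move=> mA mB; rewrite lerBlDr -[X in pr P X <= _](setUIDK A B) setUC.
by apply: prU_le; [exact: measurableD|exact: measurableI].
Qed.

Lemma pr_big_le {R : realType} {d} {T : measurableType d} (P : probability T R)
  (I : Type) (r : seq I) (A : I -> set T) : (forall i, measurable (A i)) ->
  pr P (\big[setU/set0]_(i <- r) A i) <= \sum_(i <- r) pr P (A i).
Proof.
move=> mA; elim: r => [|i r IH]; first by rewrite !big_nil /pr measure0.
rewrite !big_cons; apply: (le_trans (prU_le _ _ _)) => //.
  exact: bigsetU_measurable.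
by rewrite lerD2l.
Qed.

Lemma pr_big_disjoint {R : realType} {d} {T : measurableType d} (P : probability T R)
  (I : choiceType) (r : seq I) (A : I -> set T) : uniq r ->
  (forall i, measurable (A i)) ->
  (forall i j, i \in r -> j \in r -> A i `&` A j !=set0 -> i = j) ->
  pr P (\big[setU/set0]_(i <- r) A i) = \sum_(i <- r) pr P (A i).
Proof.
move=> ur mA; elim: r ur => [|i r IH] /=; first by rewrite !big_nil /pr measure0.
move=> /andP[ir ur] Ad; rewrite !big_cons -IH//; last first.
  by move=> j k jr kr; apply: Ad; rewrite inE ?jr ?kr orbT.
have mr : measurable (\big[setU/set0]_(j <- r) A j) by exact: bigsetU_measurable.
apply: EFin_inj; rewrite EFinD -!prE//; last exact: measurableU.
rewrite measureU// -subset0 => w [Aiw].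
rewrite -bigcup_seq => -[j /= jr Ajw].
move: ir; rewrite (Ad i j) ?jr ?inE ?eqxx ?jr ?orbT//.
by exists w.
Qed.

Lemma measurable_all {d} {T : measurableType d} (I : Type) (r : seq I)
  (b : I -> T -> bool) : (forall i, measurable [set w | b i w]) ->
  measurable [set w | all (b ^~ w) r].
Proof.
move=> mb; elim: r => [|i r IH] /=; first by rewrite (_ : mkset _ = setT)//; apply/seteqP.
rewrite (_ : mkset _ = [set w | b i w] `&` [set w | all (b ^~ w) r]).
  exact: measurableI.
by apply/seteqP; split => w /=; [move/andP|move=> [-> ->]].
Qed.

Lemma measurable_count {d} {T : measurableType d} (I : Type) (r : seq I)
  (b : I -> T -> bool) k : (forall i, measurable [set w | b i w]) ->
  measurable [set w | (k <= count (b ^~ w) r)%N].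
Proof.
move=> mb; elim: r k => [|i r IH] [|k] /=.
- by rewrite (_ : mkset _ = setT)//; apply/seteqP.
- by rewrite (_ : mkset _ = set0)//; apply/seteqP; split => w.
- by rewrite (_ : mkset _ = setT)//; apply/seteqP.
rewrite (_ : mkset _ = ([set w | b i w] `&` [set w | (k <= count (b ^~ w) r)%N]) `|`
  [set w | (k.+1 <= count (b ^~ w) r)%N]).
  by apply: measurableU => //; exact: measurableI.
apply/seteqP; split => w /=.
  by case: (b i w) => /=; [rewrite add1n ltnS; left|rewrite add0n; right].
by move=> [[-> h]|h]; [rewrite add1n ltnS|exact: leq_trans h (leq_addl _ _)].
Qed.

(* The union bound over the [k]-subsets of [L], as an induction on [L]. *)
Lemma indep_count_le {R : realType} {d} {T : measurableType d} (P : probability T R)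
  (X : int -> T -> R) (b : int -> R -> bool) :
  (forall i, measurable_fun setT (X i)) -> mutually_independent P X ->
  (forall i, measurable [set x | b i x]) ->
  forall L S k, uniq (S ++ L) ->
  pr P [set w | all (fun i => b i (X i w)) S && (k <= count (fun i => b i (X i w)) L)%N]
  <= \prod_(i <- S) pr P [set w | b i (X i w)] *
     (\sum_(i <- L) pr P [set w | b i (X i w)]) ^+ k.
Proof.
move=> mX iX mb.
have mbX i : measurable [set w | b i (X i w)].
  by have := mX i measurableT _ (mb i); rewrite setTI.
have mE S L k : measurable [set w | all (fun i => b i (X i w)) S &&
    (k <= count (fun i => b i (X i w)) L)%N].
  rewrite (_ : mkset _ = [set w | all (fun i => b i (X i w)) S] `&`
    [set w | (k <= count (fun i => b i (X i w)) L)%N]).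
    by apply: measurableI; [exact: measurable_all|exact: measurable_count].
  by apply/seteqP; split => w /=; [move/andP|move=> [-> ->]].
have Sprod S : uniq S -> pr P [set w | all (fun i => b i (X i w)) S] =
    \prod_(i <- S) pr P [set w | b i (X i w)].
  move=> uS; apply: EFin_inj; rewrite -prE; last exact: measurable_all.
  rewrite (_ : [set w | all _ _] = \big[setI/setT]_(i <- S) (X i @^-1` [set x | b i x])).
    by rewrite iX// -prodEFin; apply: eq_bigr => i _; rewrite -prE.
  elim: S {uS} => [|i S IH]; first by rewrite big_nil; apply/seteqP.
  rewrite big_cons -IH; apply/seteqP; split => w /=; first by move/andP.
  by move=> [-> ->].
have sum0 L : 0 <= \sum_(i <- L) pr P [set w | b i (X i w)].
  by apply: sumr_ge0 => i _; exact: pr_ge0.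
have prod0 S : 0 <= \prod_(i <- S) pr P [set w | b i (X i w)].
  by apply: prodr_ge0 => i _; exact: pr_ge0.
elim=> [|x l IH] S [|k] uSL.
- rewrite expr0 mulr1 -Sprod; last by rewrite cats0 in uSL.
  by apply: le_pr => // [|w /=]; [exact: measurable_all|rewrite andbT].
- rewrite (_ : mkset _ = set0); last by apply/seteqP; split => w //=; rewrite andbF.
  by rewrite /pr measure0 mulr_ge0 ?exprn_ge0.
- rewrite expr0 mulr1 -Sprod; last by move: uSL; rewrite cat_uniq => /and3P[].
  by apply: le_pr => // [|w /=]; [exact: measurable_all|rewrite andbT].
have u1 : uniq (S ++ l) by apply: subseq_uniq uSL; rewrite cat_subseq// subseq_cons.
have u2 : uniq ((x :: S) ++ l).
  by rewrite -(perm_uniq (s1 := S ++ x :: l))// -[x :: l]cat1s perm_catCA.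
(* Either [x] is not a jump, or it joins the prescribed set [S] and one jump fewer remains to be
   found in [l]; [S] is there to receive such indices. *)
have h1 := IH S k.+1 u1; have h2 := IH (x :: S) k u2.
rewrite big_cons in h2; rewrite big_cons.
set s := \sum_(i <- l) _ in h1 h2 *; set q := \prod_(i <- S) _ in h1 h2 *.
set p := pr P [set w | b x _] in h2 *.
apply: (@le_trans _ _ (q * s ^+ k.+1 + p * q * s ^+ k)).
  apply: le_trans (lerD h1 h2); apply: le_trans (prU_le P (mE _ _ _) (mE _ _ _)).
  apply: le_pr => //; first exact: measurableU.
  move=> w /=; case: (b x (X x w)) => /=; rewrite ?add1n ?add0n ?ltnS => /andP[-> ->].
    by right.
  by left.
have p0 : 0 <= p by exact: pr_ge0.
have -> : q * s ^+ k.+1 + p * q * s ^+ k = q * ((p + s) * s ^+ k) by rewrite exprS; ring.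
have s0 : 0 <= s by exact: sum0.
apply: ler_wpM2l; first exact: prod0.
rewrite exprS; apply: ler_wpM2l; first exact: addr_ge0.
by apply: lerXn2r; rewrite ?nnegrE ?addr_ge0// lerDr.
Qed.

Lemma measurable_lt_mul {R : realType} (c s : R) : measurable [set x : R | s < c * x].
Proof.
rewrite (_ : mkset _ = (fun x : R => c * x) @^-1` `]s, +oo[%classic); last first.
  by apply/seteqP; split => x /=; rewrite in_itv/= andbT.
rewrite -[X in measurable X]setTI.
have mf : measurable_fun setT (fun x : R => c * x).
  by exact: mulrl_measurable.
by apply: mf => //; exact: measurable_itv.
Qed.

Lemma measurable_lt_normM {R : realType} (c s : R) : measurable [set x : R | s < `|c * x|].
Proof.
rewrite (_ : mkset _ = [set x : R | s < c * x] `|` [set x : R | s < - c * x]).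
  by apply: measurableU; exact: measurable_lt_mul.
by apply/seteqP; split => x /=; rewrite ltr_normr mulNr => /orP.
Qed.

(** Fatou for events: outside a null set, [A] lies in the increasing union of the tail intersections
    of [An], and each of these has probability at most [v]. *)
Lemma ge_ae_limit {R : realType} {d} {T : measurableType d} (P : probability T R)
  (A : set T) (An : nat -> set T) (v : R) (n0 : nat) :
  measurable A -> (forall n, measurable (An n)) ->
  {ae P, forall w, A w -> \forall n \near \oo, An n w} ->
  (forall n, (n0 <= n)%N -> pr P (An n) <= v) -> pr P A <= v.
Proof.
move=> mA mAn [N [mN N0 AN]] Av.
pose Bm m := \bigcap_(n in [set n | (m <= n)%N]) An n.
have mB m : measurable (Bm m) by apply: bigcap_measurable => //; exists m => /=.
have ndB : nondecreasing_seq Bm.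
  move=> m n mn; apply/subsetPset => w Bw k /= nk; apply: Bw => /=.
  exact: leq_trans mn nk.
have mU : measurable (\bigcup_m Bm m) by exact: bigcup_measurable.
have /cvg_lim limB := nondecreasing_cvg_mu (mu := P) mB mU ndB.
have UB : (P (\bigcup_m Bm m) <= v%:E)%E.
  rewrite -limB//; apply: lime_le.
    by apply/cvg_ex; eexists; exact: nondecreasing_cvg_mu.
  near=> m; rewrite /= prE// lee_fin (le_trans _ (Av (maxn n0 m) (leq_maxl _ _)))//.
  by apply: le_pr => // w; apply => /=; exact: leq_maxr.
have : A `<=` (\bigcup_m Bm m) `|` N.
  move=> w Aw; have [[m _ mP]|h] := pselect (\forall n \near \oo, An n w).
    by left; exists m.
  by right; apply: AN => /=; apply/not_implyP.
move=> /(le_pr P mA (measurableU _ _ mU mN)) /le_trans; apply.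
apply: (le_trans (prU_le P mU mN)).
by rewrite {2}/pr N0/= addr0 -lee_fin -prE.
Unshelve. all: by end_near. Qed.

(** For [c < 0] the point is that the left limit of [F] at [s / c] equals the probability of
    [Y < s / c], by continuity from below. *)
Lemma Mbar_pr {R : realType} {d} {T : measurableType d} (P : probability T R)
  (Y : T -> R) (F : R -> R) : measurable_fun setT Y ->
  (forall t, P [set w | Y w <= t] = (F t)%:E) ->
  forall c s, Mbar F c s = pr P [set w | s < c * Y w].
Proof.
move=> mY YF c s.
have mS (B : set R) : measurable B -> measurable (Y @^-1` B).
  by move=> mB; rewrite -[X in measurable X]setTI; exact: mY.
have mle t : measurable [set w | Y w <= t].
  have := mS _ (measurable_itv `]-oo, t]).
  by congr measurable; apply/seteqP; split => w /=; rewrite in_itv.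
have mlt t : measurable [set w | Y w < t].
  have := mS _ (measurable_itv `]-oo, t[).
  by congr measurable; apply/seteqP; split => w /=; rewrite in_itv.
have FE t : F t = pr P [set w | Y w <= t] by rewrite /pr YF.
have Fnd x y : x <= y -> F x <= F y.
  by move=> xy; rewrite !FE le_pr// => w /= /le_trans; apply.
rewrite /Mbar; case: ltgtP => [c0|c0|<-].
- rewrite FE -prC//; congr (pr P _); apply/seteqP; split => w /=.
    by move=> /negP; rewrite -ltNge ltr_pdivrMr// mulrC.
  by move=> h; apply/negP; rewrite -ltNge ltr_pdivrMr// mulrC.
- have -> : [set w | s < c * Y w] = [set w | Y w < s / c].
    by apply/seteqP; split => w /=; rewrite ltr_ndivlMr// mulrC.
  set x := s / c; apply: cvg_lim => //.
  (* Monotonicity of [F] extends the convergence along these points to the whole left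
     neighbourhood. *)
  pose Bn n := [set w | Y w <= x - n.+1%:R^-1].
  have ndB : nondecreasing_seq Bn.
    move=> m n mn; apply/subsetPset => w /= /le_trans; apply.
    by rewrite lerD2l lerN2 lef_pV2 ?posrE// ler_nat ltnS.
  have UB : \bigcup_n Bn n = [set w | Y w < x].
    apply/seteqP; split => [w [n _]|w /= Yx]; rewrite /Bn/=.
      by move=> /le_lt_trans; apply; rewrite ltrBlDr ltrDl invr_gt0.
    have xY : 0 < x - Y w by rewrite subr_gt0.
    exists (Num.truncn (x - Y w)^-1) => //=; rewrite lerBrDr -lerBrDl.
    by rewrite -[leRHS]invrK lef_pV2 ?posrE ?invr_gt0// ltW// truncnS_gt.
  have mB n : measurable (Bn n) by exact: mle.
  have mU : measurable (\bigcup_n Bn n) by rewrite UB.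
  have cB : P \o Bn @ \oo --> (pr P [set w | (Y w < x)%R])%:E.
    by rewrite -(prE P (mlt x)) -UB; exact: nondecreasing_cvg_mu.
  have /fine_cvgP[_ /cvgrPdist_lt cB'] := cB.
  apply/cvgrPdist_le => e e0; have [n _ /(_ n (leqnn n)) Bn_e] := cB' _ e0.
  near=> u.
  have ux : u < x by near: u; exact: nbhs_left_lt.
  have nu : x - n.+1%:R^-1 <= u.
    near: u; apply: nbhs_left_ge; by rewrite ltrBlDr ltrDl invr_gt0.
  have h1 : F u <= pr P [set w | Y w < x].
    by rewrite FE le_pr// => w /= /le_lt_trans; apply.
  have h2 := Fnd _ _ nu.
  have h3 : pr P [set w | Y w < x] - F (x - n.+1%:R^-1) < e.
    by move: Bn_e; rewrite /= -/(pr P (Bn n)) FE => /(le_lt_trans (ler_norm _)).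
  rewrite ger0_norm ?subr_ge0//; lra.
- case: ifPn => s0.
    rewrite (_ : mkset _ = setT); first by rewrite /pr probability_setT.
    by apply/seteqP; split => w //= _; rewrite mul0r.
  rewrite (_ : mkset _ = set0); first by rewrite /pr measure0.
  by apply/seteqP; split => w //=; rewrite mul0r (negbTE s0).
Unshelve. all: by end_near. Qed.

(** Pointwise pigeonhole: the jumps alone sum to more than [t - tau], so one of them exceeds their
    average. *)
Lemma sum_jumps {R : realType} (L : seq int) (u theta : int -> R) (tau t : R) :
  uniq L -> (forall i, 0 <= theta i) -> \sum_(i <- L) theta i <= tau -> 0 < tau -> tau < t ->
  t < \sum_(i <- L) u i ->
  (exists2 j, j \in L & t - tau < u j) \/
  exists k j, [/\ (2 <= k <= size L)%N, j \in L, (t - tau) / k%:R < u j &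
    (k.-1 <= count (fun i => (theta i < `|u i|)%R) (rem j L))%N].
Proof.
move=> uL th0 Lth tau0 taut tu.
pose b i := theta i < `|u i|.
pose k := count b L.
have uJ : t - tau < \sum_(i <- L | b i) u i.
  rewrite ltrBlDr (lt_le_trans tu)// (bigID b)/= lerD2l (le_trans _ Lth)//.
  rewrite [leRHS](bigID b)/= ler_wpDl ?sumr_ge0//.
  apply: ler_sum => i; rewrite /b -leNgt; exact: le_trans (ler_norm _).
have [j [jL bj uj]] : exists j, [/\ j \in L, b j & (t - tau) / k%:R < u j].
  apply: contrapT => h; move: uJ; rewrite ltNge => /negP; apply.
  apply: (@le_trans _ _ (\sum_(i <- L | b i) (t - tau) / k%:R)).
    rewrite [leLHS]big_seq_cond [leRHS]big_seq_cond; apply: ler_sum => i /andP[iL bi].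
    by rewrite leNgt; apply/negP => ui; apply: h; exists i.
  rewrite big_const_seq -/k iter_addr_0 -[leLHS]mulr_natr.
  (* Without jumps the product is 0, and [tau < t] closes the case. *)
  have [->|k0] := eqVneq k 0%N; first by rewrite mulr0; lra.
  by rewrite divfK// pnatr_eq0.
have k0 : (0 < k)%N by rewrite -has_count; apply/hasP; exists j.
have [k1|k1] := leqP k 1.
  left; exists j => //; have kE : k = 1%N by apply/eqP; rewrite eqn_leq k1.
  by move: uj; rewrite kE divr1.
right; exists k, j; split => //; first by rewrite k1 count_size.
by rewrite count_rem jL/= (bj : (theta j < _)%R) -subn1.
Qed.

Lemma sum_rem_le {R : realType} (I : eqType) (L : seq I) (f : I -> R) j :
  (forall i, 0 <= f i) -> \sum_(i <- rem j L) f i <= \sum_(i <- L) f i.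
Proof.
move=> f0; have [jL|jL] := boolP (j \in L); last by rewrite rem_id.
by rewrite [leRHS](perm_big _ (perm_to_rem jL)) big_cons/= lerDr.
Qed.

Lemma uniq_cons_rem (I : eqType) (L : seq I) j : uniq L -> uniq (j :: rem j L).
Proof. by move=> uL; rewrite /= mem_rem_uniq// !inE eqxx/= rem_uniq. Qed.

Lemma pr_jump_count {R : realType} {d} {T : measurableType d} (P : probability T R)
  (X : int -> T -> R) (c theta : int -> R) :
  (forall i, measurable_fun setT (X i)) -> mutually_independent P X ->
  forall L j k s, uniq L ->
  pr P [set w | (s < c j * X j w) &&
    (k <= count (fun i => (theta i < `|c i * X i w|)%R) (rem j L))%N] <=
  pr P [set w | s < c j * X j w] *
  (\sum_(i <- L) pr P [set w | theta i < `|c i * X i w|]) ^+ k.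
Proof.
move=> mX iX L j k s uL.
(* Index [j] carries the event of a large signed term, all others the jump event; the set of
   prescribed indices is [[:: j]], so the large term factors out. *)
pose b i x := if i == j then s < c j * x else theta i < `|c i * x|.
have mb i : measurable [set x | b i x].
  by rewrite /b; case: eqP => _; [exact: measurable_lt_mul|exact: measurable_lt_normM].
have := indep_count_le mX iX mb (L := rem j L) (S := [:: j]) k (uniq_cons_rem j uL).
have bE w : count (fun i => b i (X i w)) (rem j L) =
    count (fun i => theta i < `|c i * X i w|) (rem j L).
  by apply: eq_in_count => i; rewrite mem_rem_uniq// inE /b => /andP[/negbTE ->].
under eq_set do rewrite bE /= andbT {1}/b eqxx.
rewrite big_seq1 {1}/b eqxx => /le_trans; apply.
apply: ler_wpM2l; first exact: pr_ge0.
apply: lerXn2r; rewrite ?nnegrE; first by apply: sumr_ge0 => i _; exact: pr_ge0.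
  by apply: sumr_ge0 => i _; exact: pr_ge0.
apply: (@le_trans _ _ (\sum_(i <- rem j L) pr P [set w | theta i < `|c i * X i w|])).
  rewrite [leLHS]big_seq_cond [leRHS]big_seq_cond ler_sum// => i.
  by rewrite mem_rem_uniq// !inE /b andbT => /andP[/negbTE ->].
by apply: sum_rem_le => i; exact: pr_ge0.
Qed.

Lemma pr_sum_le {R : realType} {d} {T : measurableType d} (P : probability T R)
  (X : int -> T -> R) (c theta : int -> R) (L : seq int) (tau t : R) :
  (forall i, measurable_fun setT (X i)) -> mutually_independent P X ->
  uniq L -> (forall i, 0 <= theta i) -> \sum_(i <- L) theta i <= tau -> 0 < tau -> tau < t ->
  pr P [set w | t < \sum_(i <- L) c i * X i w] <=
  \sum_(j <- L) pr P [set w | t - tau < c j * X j w] +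
  \sum_(2 <= k < (size L).+1) (\sum_(j <- L) pr P [set w | (t - tau) / k%:R < c j * X j w]) *
    (\sum_(i <- L) pr P [set w | theta i < `|c i * X i w|]) ^+ k.-1.
Proof.
move=> mX iX uL th0 Lth tau0 taut.
have mXB i (B : set R) : measurable B -> measurable (X i @^-1` B).
  by move=> mB; rewrite -[X in measurable X]setTI; exact: mX.
have m1 s j : measurable [set w | s < c j * X j w].
  exact: (mXB j _ (measurable_lt_mul (c j) s)).
have m2 j : measurable [set w | theta j < `|c j * X j w|].
  exact: (mXB j _ (measurable_lt_normM (c j) (theta j))).
pose E k j := [set w | ((t - tau) / k%:R < c j * X j w) &&
    (k.-1 <= count (fun i => (theta i < `|c i * X i w|)%R) (rem j L))%N].
have mE k j : measurable (E k j).
  rewrite (_ : E k j = [set w | (t - tau) / k%:R < c j * X j w] `&` [set w |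
    (k.-1 <= count (fun i => (theta i < `|c i * X i w|)%R) (rem j L))%N]).
    by apply: measurableI => //; exact: (@measurable_count _ _ _ _ (fun i w => theta i < `|c i * X i w|)).
  by apply/seteqP; split => w; rewrite /E/=; [move/andP|move=> [-> ->]].
have mS : measurable [set w | t < \sum_(i <- L) c i * X i w].
  rewrite (_ : mkset _ = (fun w => \sum_(i <- L) c i * X i w) @^-1` `]t, +oo[%classic).
    rewrite -[X in measurable X]setTI; apply: measurable_sum => // i.
    by apply: measurable_funM.
  by apply/seteqP; split => w /=; rewrite in_itv/= andbT.
pose U1 := \big[setU/set0]_(j <- L) [set w | t - tau < c j * X j w].
pose U2 := \big[setU/set0]_(k <- index_iota 2 (size L).+1) \big[setU/set0]_(j <- L) E k j.
have mU1 : measurable U1 by exact: bigsetU_measurable.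
have mU2' k : measurable (\big[setU/set0]_(j <- L) E k j) by exact: bigsetU_measurable.
have mU2 : measurable U2 by exact: bigsetU_measurable.
apply: (@le_trans _ _ (pr P (U1 `|` U2))).
  apply: le_pr => // [|w /= tw]; first exact: measurableU.
  have [[j jL tj]|[k [j [kL jL tj jc]]]] := sum_jumps uL th0 Lth tau0 taut tw.
    by left; rewrite /U1 -bigcup_seq; exists j.
  right; rewrite /U2 -bigcup_seq; exists k; first by rewrite /= mem_index_iota ltnS.
  by rewrite -bigcup_seq; exists j => //; rewrite /E /= tj.
apply: (le_trans (prU_le P mU1 mU2)); apply: lerD; first exact: pr_big_le.
apply: (le_trans (pr_big_le _ _ _)) => //; apply: ler_sum => k _.
apply: (le_trans (pr_big_le _ _ _)) => //; rewrite mulr_suml; apply: ler_sum => j _.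
exact: pr_jump_count.
Qed.

Lemma pr_sum_ge {R : realType} {d} {T : measurableType d} (P : probability T R)
  (X : int -> T -> R) (c theta : int -> R) (L D : seq int) (tau s : R) :
  (forall i, measurable_fun setT (X i)) -> mutually_independent P X ->
  uniq L -> uniq D -> {subset D <= L} ->
  (forall i, 0 <= theta i) -> \sum_(i <- L) theta i <= tau -> 0 <= s ->
  (\sum_(j <- D) pr P [set w | s + tau < c j * X j w]) *
    (1 - \sum_(i <- L) pr P [set w | theta i < `|c i * X i w|]) <=
  pr P [set w | s < \sum_(i <- L) c i * X i w].
Proof.
move=> mX iX uL uD DL th0 Lth s0.
have mXB i (B : set R) : measurable B -> measurable (X i @^-1` B).
  by move=> mB; rewrite -[X in measurable X]setTI; exact: mX.
have m1 r j : measurable [set w | r < c j * X j w].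
  exact: (mXB j _ (measurable_lt_mul (c j) r)).
have m2 j : measurable [set w | theta j < `|c j * X j w|].
  exact: (mXB j _ (measurable_lt_normM (c j) (theta j))).
have mS : measurable [set w | s < \sum_(i <- L) c i * X i w].
  rewrite (_ : mkset _ = (fun w => \sum_(i <- L) c i * X i w) @^-1` `]s, +oo[%classic).
    rewrite -[X in measurable X]setTI; apply: measurable_sum => // i.
    by apply: measurable_funM.
  by apply/seteqP; split => w /=; rewrite in_itv/= andbT.
pose N j := [set w | (1 <= count (fun i => (theta i < `|c i * X i w|)%R) (rem j L))%N].
have mN j : measurable (N j) by exact: (@measurable_count _ _ _ _ (fun i w => theta i < `|c i * X i w|)).
pose A j := [set w | s + tau < c j * X j w] `\` N j.
have mA j : measurable (A j) by exact: measurableD.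
have NP j w : ~ N j w -> forall i, i \in rem j L -> `|c i * X i w| <= theta i.
  rewrite /N/= => /negP; rewrite -has_count => /hasPn h i iL.
  by rewrite leNgt; exact: h.
(* If [i] and [j] differ, the event of [i] forces [c i * X i] above [tau >= theta i], a jump other
   than [j], which the event of [j] excludes. *)
have Ad i j : i \in D -> j \in D -> A i `&` A j !=set0 -> i = j.
  move=> iD jD [w [[/= ci _] [/= _ /NP nj]]]; apply/eqP/negPn/negP => ij.
  have := nj i; rewrite mem_rem_uniq// !inE ij DL// => /(_ isT); apply/negP; rewrite -ltNge.
  apply: le_lt_trans (lt_le_trans ci (ler_norm _)).
  rewrite (le_trans _ (_ : tau <= _)) ?lerDr//; apply: le_trans Lth.
  by rewrite (perm_big _ (perm_to_rem (DL _ iD))) big_cons/= lerDl sumr_ge0.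
apply: (@le_trans _ _ (pr P (\big[setU/set0]_(j <- D) A j))); last first.
  apply: le_pr => //; first exact: bigsetU_measurable.
  move=> w; rewrite -bigcup_seq => -[j /= jD [/= cj /NP nj]].
  rewrite (perm_big _ (perm_to_rem (DL _ jD))) big_cons/=.
  have : - tau <= \sum_(i <- rem j L) c i * X i w.
    apply: (@le_trans _ _ (- \sum_(i <- rem j L) theta i)).
      by rewrite lerN2 (le_trans _ Lth)// sum_rem_le.
    rewrite -sumrN [leLHS]big_seq [leRHS]big_seq; apply: ler_sum => i /nj.
    by rewrite ler_norml => /andP[].
  lra.
rewrite pr_big_disjoint// mulr_suml; apply: ler_sum => j _.
apply: le_trans (prD_ge P (m1 _ j) (mN j)).
rewrite mulrBr mulr1 lerD2l lerN2.
have := @pr_jump_count _ _ _ P X c theta mX iX L j 1 (s + tau) uL; rewrite expr1.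
apply: le_trans; rewrite le_eqVlt; apply/orP; left; apply/eqP; congr (pr P _).
by apply/seteqP; split => w /=; [move=> [-> ->]|move/andP].
Qed.

(** * Uniform asymptotics of finite weighted sums *)

Lemma near_all_seq {R : realType} (I : eqType) (r : seq I) (Q : I -> R -> Prop) :
  (forall i, i \in r -> \forall t \near +oo, Q i t) ->
  \forall t \near +oo, forall i, i \in r -> Q i t.
Proof.
elim: r => [|i r IH] Qr; first by near=> t.
have Qi := Qr i (mem_head _ _).
have {}IH : \forall t \near +oo, forall j, j \in r -> Q j t.
  by apply: IH => j jr; apply: Qr; rewrite inE jr orbT.
near=> t.
have Qt : Q i t by near: t.
have Qr' : forall j, j \in r -> Q j t by near: t.
by move=> j; rewrite inE => /predU1P[->//|]; exact: Qr'.
Unshelve. all: by end_near. Qed.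

Lemma sum_half_le2 {R : realType} n : \sum_(0 <= i < n) (2^-1 : R) ^+ i <= 2.
Proof.
suff -> : \sum_(0 <= i < n) (2^-1 : R) ^+ i = 2 - 2 * 2^-1 ^+ n.
  by rewrite gerBl mulr_ge0 ?exprn_ge0 ?invr_ge0.
elim: n => [|n IH]; first by rewrite big_nil expr0; ring.
by rewrite big_nat_recr//= IH exprS; field.
Qed.

(** A series dominated by a geometric one: the first term [t ^+ 2 * p] is at most [t ^- 2], and the
    ratio [t * p] is at most [t ^- 3], hence at most one half. *)
Lemma sum_crowd_le {R : realType} (t p : R) n : 2 <= t -> 0 <= p <= t ^- 4 ->
  \sum_(2 <= k < n) t ^+ k * p ^+ k.-1 <= 2 / t.
Proof.
move=> t2 /andP[p0 pt].
have t0 : 0 < t by lra.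
rewrite -{1}[2%N]add0n big_addn.
apply: (@le_trans _ _ (\sum_(0 <= i < n - 2) t^-1 * 2^-1 ^+ i)); last first.
  by rewrite -mulr_sumr mulrC ler_wpM2r ?invr_ge0 ?(ltW t0)// sum_half_le2.
apply: ler_sum => i _; rewrite addn2/=.
apply: (@le_trans _ _ (t ^+ i.+2 * (t ^- 4) ^+ i.+1)).
  by rewrite ler_wpM2l ?exprn_ge0 ?(ltW t0)// lerXn2r// nnegrE ?invr_ge0 ?exprn_ge0// ltW.
have -> : t ^+ i.+2 * (t ^- 4) ^+ i.+1 = t ^- 2 * (t ^- 3) ^+ i.
  rewrite !exprVn -!exprM -invfM -exprD.
  have -> : (4 * i.+1 = i.+2 + (2 + 3 * i))%N by lia.
  by rewrite exprD invfM mulrA divff ?mul1r// expf_neq0// gt_eqF.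
apply: ler_pM; rewrite ?exprn_ge0 ?invr_ge0 ?exprn_ge0 ?(ltW t0)//.
  by rewrite lef_pV2 ?posrE ?exprn_gt0// expr2; nra.
apply: lerXn2r; rewrite ?nnegrE ?invr_ge0 ?exprn_ge0 ?(ltW t0)//.
rewrite lef_pV2 ?posrE ?exprn_gt0// (le_trans t2)// exprS ler_peMr ?(ltW t0)//.
by rewrite exprn_ege1//; lra.
Qed.

Lemma sum_nat_crowd_le {R : realType} (f : nat -> R) (C t p : R) n :
  0 <= C -> 2 <= t -> 0 <= p <= t ^- 4 ->
  (forall k, (0 < k)%N -> f k <= C * t ^+ k) ->
  \sum_(2 <= k < n) f k * p ^+ k.-1 <= C * (2 / t).
Proof.
move=> C0 t2 pt fC.
apply: (@le_trans _ _ (\sum_(2 <= k < n) C * (t ^+ k * p ^+ k.-1))).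
  rewrite [leLHS]big_nat_cond [leRHS]big_nat_cond.
  apply: ler_sum => k /andP[/andP[k2 _] _].
  rewrite mulrA ler_wpM2r ?exprn_ge0//; first by case/andP: pt.
  by apply: fC; exact: ltnW.
by rewrite -mulr_sumr ler_wpM2l// sum_crowd_le.
Qed.

Lemma sum_powR_le1 {R : realType} (I : Type) (r : seq I) (c : I -> R) (a B delta : R) :
  0 < delta < 1 -> (forall i, `|c i| <= a) -> \sum_(i <- r) `|c i| `^ delta <= B ->
  \sum_(i <- r) `|c i| <= a `^ (1 - delta) * B.
Proof.
move=> /andP[d0 d1] ca cB.
apply: (@le_trans _ _ (\sum_(i <- r) a `^ (1 - delta) * `|c i| `^ delta)).
  apply: ler_sum => i _; rewrite -[leLHS]powRr1//.
  by apply: powR_le_scale; rewrite ?d0 ?(ltW d1) ?normr_ge0 ?ca.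
by rewrite -mulr_sumr ler_wpM2l ?powR_ge0.
Qed.

(* [M c] is the tail of [c X]; the left tail [M (-1)] may vanish, hence no positivity for it. *)
Definition tails {R : realType} (M : R -> R -> R) :=
  [/\ forall c x, 0 <= M c x <= 1,
      forall x, 0 <= x -> M 0 x = 0,
      forall c x, 0 < c -> M c x = M 1 (x / c),
      forall c x, c < 0 -> M c x = M (-1) (x / - c) &
      [/\ forall c x y, x <= y -> M c y <= M c x,
      forall x, 0 < M 1 x, decay (M 1), slow (M 1) /\ slow (M (-1)) &
      exists2 C, 0 < C & \forall x \near +oo, M (-1) x <= C * M 1 x]].

Lemma tails_dominated {R : realType} (M : R -> R -> R) : tails M -> dominated M (M 1).
Proof.
move=> [M01 M0 Mp Mn [_ K0 _ _ [C C0 [u [_ KC]]]]]; split => //.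
exists (1 + C), (u + 1); split; first by lra.
move=> c x; rewrite neq_lt => /orP[c0|c0] xu.
  rewrite Mn//; move: xu; rewrite ltr0_norm// => xu.
  apply: le_trans (KC _ _) _; first by lra.
  by rewrite ler_wpM2r ?(ltW (K0 _))//; lra.
rewrite Mp//; move: xu; rewrite gtr0_norm// => xu.
by rewrite ler_peMl ?(ltW (K0 _))//; lra.
Qed.

Lemma tails_shift {R : realType} (M : R -> R -> R) (c b eps : R) :
  tails M -> c != 0 -> 0 < b -> 0 < eps ->
  \forall t \near +oo, M c (t - 2 * Num.sqrt t) <= M c t + eps * M 1 (t / b) /\
    M c t <= M c (t + 2 * Num.sqrt t) + eps * M 1 (t / b).
Proof.
move=> [M01 M0 Mp Mn [Mnd K0 Kd [Ks Kms] [C C0 KC]]] c0 b0 eps0.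
have K0' s x : 0 <= M s x by case/andP: (M01 s x).
have KC1 : \forall x \near +oo, M 1 x <= 1 * M 1 x by near=> x; rewrite mul1r.
move: c0; rewrite neq_lt => /orP[c0|c0].
  have c0' : 0 < - c by rewrite oppr_gt0.
  have h1 := slow_shift (K0' (-1)) Kms (K0' 1) (Mnd 1) Ks C0 KC c0' b0 eps0.
  have h2 := slow_shift_right (K0' (-1)) (Mnd (-1)) Kms (K0' 1) (Mnd 1) Ks C0 KC c0' b0 eps0.
  by near=> t; rewrite !(Mn c)//; split; near: t.
have h1 := slow_shift (K0' 1) Ks (K0' 1) (Mnd 1) Ks ltr01 KC1 c0 b0 eps0.
have h2 := slow_shift_right (K0' 1) (Mnd 1) Ks (K0' 1) (Mnd 1) Ks ltr01 KC1 c0 b0 eps0.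
by near=> t; rewrite !(Mp c)//; split; near: t.
Unshelve. all: by end_near. Qed.

Lemma sum_theta {R : realType} (I : Type) (r : seq I) (c : I -> R) (B delta t : R) :
  0 < B -> 0 < t -> \sum_(i <- r) `|c i| `^ delta <= B ->
  \sum_(i <- r) `|c i| `^ delta * (Num.sqrt t / (2 * B)) <= Num.sqrt t / 2.
Proof.
move=> B0 t0 cB; rewrite -mulr_suml.
apply: (@le_trans _ _ (B * (Num.sqrt t / (2 * B)))).
  by rewrite ler_wpM2r// divr_ge0 ?sqrtr_ge0// mulr_ge0// ltW.
by rewrite le_eqVlt; apply/orP; left; apply/eqP; field; rewrite gt_eqF.
Qed.

Lemma pr_jump_le {R : realType} {d} {T : measurableType d} (P : probability T R)
  (X : int -> T -> R) (F : R -> R) (c : int -> R) (a B delta : R) :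
  (forall i, measurable_fun setT (X i)) ->
  (forall i t, P [set w | X i w <= t] = (F t)%:E) -> tails (Mbar F) ->
  0 < a -> 0 < B -> 0 < delta < 1 -> (forall i, `|c i| <= a) ->
  \forall t \near +oo, forall L, \sum_(i <- L) `|c i| `^ delta <= B ->
  0 <= \sum_(i <- L) pr P [set w |
    `|c i| `^ delta * (Num.sqrt t / (2 * B)) < `|c i * X i w|] <= t ^- 4.
Proof.
move=> mX XF Mt a0 B0 d01 ca.
have [_ _ _ _ [_ K0 Kd _ _]] := Mt.
have h := dominated_jump K0 Kd (tails_dominated Mt) a0 B0 d01.
near=> t => L cB.
rewrite sumr_ge0/= => [|i _]; last exact: pr_ge0.
have mXB i (E : set R) : measurable E -> measurable (X i @^-1` E).
  by move=> mE; rewrite -[X in measurable X]setTI; exact: mX.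
pose theta i := `|c i| `^ delta * (Num.sqrt t / (2 * B)).
have ht : \sum_(i <- L) (Mbar F (c i) (theta i) + Mbar F (- c i) (theta i)) <= t ^- 4.
  have : forall (I : Type) (r : seq I) (c theta : I -> R),
    (forall i, `|c i| <= a) -> \sum_(i <- r) `|c i| `^ delta <= B ->
    (forall i, theta i = `|c i| `^ delta * (Num.sqrt t / (2 * B))) ->
    \sum_(i <- r) (Mbar F (c i) (theta i) + Mbar F (- c i) (theta i)) <= t ^- 4.
    by near: t.
  exact.
apply: le_trans ht; apply: ler_sum => i _.
rewrite !(Mbar_pr (mX i) (XF i)).
have m1 s r : measurable [set w | r < s * X i w].
  exact: (mXB i _ (measurable_lt_mul s r)).
apply: le_trans (prU_le P (m1 _ _) (m1 _ _)).
apply: le_pr; [exact: (mXB i _ (measurable_lt_normM (c i) _))|exact: measurableU|].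
by move=> w /=; rewrite -/(theta i) ltr_normr mulNr => /orP.
Unshelve. all: by end_near. Qed.

Lemma sum_large {R : realType} (L D : seq int) (c M : int -> R) (k0 : R) :
  uniq L -> uniq D -> (forall i, (i \in D) = (k0 <= `|c i|)) -> {subset D <= L} ->
  \sum_(i <- L) M i = \sum_(i <- D) M i + \sum_(i <- L | `|c i| < k0) M i.
Proof.
move=> uL uD DE DL; rewrite (bigID (fun i => k0 <= `|c i|))/=; congr (_ + _).
  rewrite -big_filter; apply: perm_big; apply: uniq_perm => // [|i]; first exact: filter_uniq.
  by rewrite mem_filter -DE; case: (boolP (i \in D)) => // /DL.
by apply: eq_bigl => i; rewrite -ltNge.
Qed.

(** A third of [eps] each goes to the shift of the terms in [D], to the weights below [k0], and to
    the outcomes with at least two jumps. The gap between [k1] and [k0] makes the second error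
    negligible uniformly over all small weights. *)
Lemma pr_sum_upper {R : realType} {d} {T : measurableType d} (P : probability T R)
  (X : int -> T -> R) (F : R -> R) (c : int -> R) (a B delta k0 k1 eps : R) (D : seq int) :
  (forall i, measurable_fun setT (X i)) -> mutually_independent P X ->
  (forall i t, P [set w | X i w <= t] = (F t)%:E) -> tails (Mbar F) ->
  0 < a -> 0 < B -> 0 < delta < 1 -> (forall i, `|c i| <= a) ->
  0 < k1 -> k1 < k0 -> (forall i, `|c i| < k0 -> `|c i| <= k1) ->
  uniq D -> (forall i, (i \in D) = (k0 <= `|c i|)) -> 0 < eps ->
  \forall t \near +oo, forall L, uniq L -> {subset D <= L} ->
  \sum_(i <- L) `|c i| `^ delta <= B ->
  pr P [set w | t < \sum_(i <- L) c i * X i w] <=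
  \sum_(i <- D) Mbar F (c i) t + eps * Mbar F 1 (t / k0).
Proof.
move=> mX iX XF Mt a0 B0 d01 ca k10 k10' gap uD DE eps0.
have k00 : 0 < k0 by exact: lt_trans k10'.
have Mdom := tails_dominated Mt.
have [M01 M0 _ _ [Mnd K0 Kd [Ks _] _]] := Mt.
have B1 : 0 < a `^ (1 - delta) * B by rewrite mulr_gt0 ?powR_gt0.
have [C1 [s1 [C10 C1P]]] := dominated_sum K0 Kd Mdom k10 B1.
have [C2 [s2 [C20 C2P]]] := dominated_sum K0 Kd Mdom a0 B1.
have [C3 C30 C3P] := dominated_poly K0 Kd Mdom 1.
(* One constant for both hypotheses of [slow_div_le]: [C2] comes from the tail bound, the other
   summand from the Markov bound of order one. *)
pose C := C2 + C3 * (a `^ (1 - delta) * B).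
have C0 : 0 < C by rewrite addr_gt0// mulr_gt0.
(* The added 1 keeps the divisor positive when [D] is empty. *)
pose n1 : R := (size D)%:R + 1.
have n10 : 0 < n1 by rewrite ltr_wpDl.
have e1 : 0 < eps / (3 * n1) by rewrite divr_gt0 ?mulr_gt0.
have e2 : 0 < eps / (3 * C1) by rewrite divr_gt0 ?mulr_gt0.
have hD : \forall t \near +oo, forall i, i \in D ->
    Mbar F (c i) (t - 2 * Num.sqrt t) <=
    Mbar F (c i) t + eps / (3 * n1) * Mbar F 1 (t / k0).
  apply: near_all_seq => i; rewrite DE => k0c.
  have c0 : c i != 0 by rewrite -normr_gt0 (lt_le_trans k00).
  have hs := tails_shift Mt c0 k00 e1.
  near=> t; suff : Mbar F (c i) (t - 2 * Num.sqrt t) <= Mbar F (c i) t + eps / (3 * n1) * Mbar F 1 (t / k0) /\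
    Mbar F (c i) t <= Mbar F (c i) (t + 2 * Num.sqrt t) + eps / (3 * n1) * Mbar F 1 (t / k0) by case.
  by near: t.
have hneg := decay_negligible (fun x => ltW (K0 x)) (Mnd 1) Kd k10 k10' e2.
have hjump := pr_jump_le mX XF Mt a0 B0 d01 ca.
have hdiv := slow_div_le s2 K0 (Mnd 1) Ks a0 k00 C0.
near=> t => L uL DL cB.
have t4 : 4 <= t by near: t; exact: near_ge.
have t0 : 0 < t by apply: lt_le_trans t4.
have t2 : 2 <= t by clear -t4; lra.
have ts1 : 2 * s1 <= t by near: t; exact: near_ge.
have tC : 6 * C / eps <= t by near: t; exact: near_ge.
set tau := Num.sqrt t.
have tau0 : 0 < tau by rewrite sqrtr_gt0.
have tau2 : tau ^+ 2 = t by rewrite sqr_sqrtr// ltW.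
have tau_2 : 2 <= tau.
  by rewrite -(ger0_norm (_ : 0 <= 2)) -?sqrtr_sqr ?ler_sqrt//; lra.
have taut : tau <= t / 2 by rewrite -tau2; clear -tau_2; nra.
have cB1 := sum_powR_le1 d01 ca cB.
pose theta i := `|c i| `^ delta * (tau / (2 * B)).
have th0 i : 0 <= theta i.
  by rewrite mulr_ge0 ?powR_ge0// divr_ge0 ?mulr_ge0 ?ltW.
have Lth : \sum_(i <- L) theta i <= tau.
  by apply: (le_trans (sum_theta B0 t0 cB)); rewrite -/tau; clear -tau0; lra.
have taut' : tau < t by clear -taut t0; lra.
apply: (le_trans (@pr_sum_le _ _ _ P X c theta L tau t mX iX uL th0 Lth tau0 taut')).
set p := \sum_(i <- L) pr P [set w | theta i < `|c i * X i w|].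
have /andP[p0 p4] : 0 <= p <= t ^- 4.
  have : forall L, \sum_(i <- L) `|c i| `^ delta <= B ->
    0 <= \sum_(i <- L) pr P [set w |
    `|c i| `^ delta * (Num.sqrt t / (2 * B)) < `|c i * X i w|] <= t ^- 4 by near: t.
  exact.
set Kt := Mbar F 1 (t / k0).
have Kt0 : 0 < Kt by exact: K0.
have prM j s : pr P [set w | s < c j * X j w] = Mbar F (c j) s.
  by rewrite (Mbar_pr (mX j) (XF j)).
under eq_bigr do rewrite prM.
under [X in _ + X <= _]eq_bigr do under eq_bigr do rewrite prM.
have part1 : \sum_(i <- L) Mbar F (c i) (t - tau) <=
    \sum_(i <- D) Mbar F (c i) t + 2 * eps / 3 * Kt.
  rewrite (sum_large _ uL uD DE DL).
  have hD' : \sum_(i <- D) Mbar F (c i) (t - tau) <=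
      \sum_(i <- D) Mbar F (c i) t + eps / 3 * Kt.
    apply: (@le_trans _ _ (\sum_(i <- D) (Mbar F (c i) t + eps / (3 * n1) * Kt))).
      rewrite [leLHS]big_seq [leRHS]big_seq; apply: ler_sum => i iD.
      apply: (@le_trans _ _ (Mbar F (c i) (t - 2 * tau))); first by apply: Mnd; clear -tau0; lra.
      have : forall i, i \in D -> Mbar F (c i) (t - 2 * Num.sqrt t) <=
        Mbar F (c i) t + eps / (3 * n1) * Mbar F 1 (t / k0) by near: t.
      exact.
    rewrite big_split/= lerD2l big_const_seq count_predT iter_addr_0 -[leLHS]mulr_natr.
    have -> : eps / (3 * n1) * Kt * (size D)%:R = eps / 3 * Kt * ((size D)%:R / n1).
      by field; rewrite gt_eqF.
    rewrite ger_pMr; last by rewrite mulr_gt0// divr_gt0.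
    by rewrite ler_pdivrMr// mul1r lerDl.
  have hL' : \sum_(i <- L | `|c i| < k0) Mbar F (c i) (t - tau) <= eps / 3 * Kt.
    apply: (@le_trans _ _ (C1 * Mbar F 1 ((t - tau) / k1))).
      apply: C1P => //; first by clear -ts1 taut; lra.
      by rewrite (le_trans _ cB1)// [leRHS](bigID (fun i => `|c i| < k0))/= lerDl sumr_ge0.
    have -> : eps / 3 * Kt = C1 * (eps / (3 * C1) * Kt) by field; rewrite gt_eqF.
    have hn : Mbar F 1 ((t - Num.sqrt t) / k1) <= eps / (3 * C1) * Mbar F 1 (t / k0).
      by near: t.
    by rewrite ler_wpM2l ?(ltW C10).
  by clear -hD' hL'; lra.
have part2 : \sum_(2 <= k < (size L).+1)
    (\sum_(i <- L) Mbar F (c i) ((t - tau) / k%:R)) * p ^+ k.-1 <= eps / 3 * Kt.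
  apply: (@le_trans _ _ (C * Kt * (2 / t))).
    apply: sum_nat_crowd_le; rewrite ?p0//; first by rewrite mulr_ge0 ?ltW.
    move=> k kpos.
    have hk : forall k v, (0 < k)%N -> v <= C * k%:R / (t - Num.sqrt t) ->
      (s2 <= (t - Num.sqrt t) / k%:R -> v <= C * Mbar F 1 ((t - Num.sqrt t) / k%:R / a)) ->
      v <= C * (t ^+ k * Mbar F 1 (t / k0)) by near: t.
    rewrite -mulrA [Kt * _]mulrC; apply: hk => //.
      apply: (@le_trans _ _ (\sum_(i <- L) C3 * (`|c i| / ((t - tau) / k%:R)))).
        apply: ler_sum => i _.
        have := C3P (c i) ((t - tau) / k%:R); rewrite expr1; apply.
        by rewrite divr_gt0 ?ltr0n ?subr_gt0.
      rewrite -mulr_sumr -mulr_suml invf_div -/tau -[leRHS]mulrA mulrA.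
      rewrite ler_wpM2r ?divr_ge0 ?subr_ge0 ?(ltW taut')//.
      by rewrite (le_trans (ler_wpM2l (ltW C30) cB1))// lerDr ltW.
    move=> sk; apply: (@le_trans _ _ (C2 * Mbar F 1 ((t - tau) / k%:R / a))).
      exact: C2P.
    by rewrite ler_wpM2r ?(ltW (K0 _))// lerDl mulr_ge0 ?ltW.
  have -> : C * Kt * (2 / t) = 2 * C / t * Kt by ring.
  rewrite ler_wpM2r ?(ltW Kt0)// ler_pdivrMr//.
  by move: tC; rewrite ler_pdivrMr//; clear; lra.
by clear -part1 part2; lra.
Unshelve. all: by end_near. Qed.

(** The margin 1 in [t + 1] is room for the passage to the limit: [S <= t] only forces the partial
    sums to be eventually at most [t + 1]. Half of [eps] pays for the shift, half for the factor
    [1 - p]. *)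
Lemma pr_sum_lower {R : realType} {d} {T : measurableType d} (P : probability T R)
  (X : int -> T -> R) (F : R -> R) (c : int -> R) (a B delta k0 eps : R) (D : seq int) :
  (forall i, measurable_fun setT (X i)) -> mutually_independent P X ->
  (forall i t, P [set w | X i w <= t] = (F t)%:E) -> tails (Mbar F) ->
  0 < a -> 0 < B -> 0 < delta < 1 -> (forall i, `|c i| <= a) ->
  0 < k0 -> uniq D -> (forall i, i \in D -> k0 <= `|c i|) -> 0 < eps ->
  \forall t \near +oo, forall L, uniq L -> {subset D <= L} ->
  \sum_(i <- L) `|c i| `^ delta <= B ->
  \sum_(i <- D) Mbar F (c i) t - eps * Mbar F 1 (t / k0) <=
  pr P [set w | t + 1 < \sum_(i <- L) c i * X i w].
Proof.
move=> mX iX XF Mt a0 B0 d01 ca k00 uD DE eps0.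
have [M01 M0 _ _ [Mnd K0 Kd [Ks _] _]] := Mt.
have [_ _ [C [x1 [C0 CP]]]] := tails_dominated Mt.
pose n1 : R := (size D)%:R + 1.
have n10 : 0 < n1 by rewrite ltr_wpDl.
have e1 : 0 < eps / (2 * n1) by rewrite divr_gt0 ?mulr_gt0.
have hD : \forall t \near +oo, forall i, i \in D ->
    Mbar F (c i) t <= Mbar F (c i) (t + 2 * Num.sqrt t) + eps / (2 * n1) * Mbar F 1 (t / k0)
    /\ Mbar F (c i) t <= C * t * Mbar F 1 (t / k0).
  apply: near_all_seq => i /DE k0c.
  have c0' : 0 < `|c i| by exact: lt_le_trans k0c.
  have c0 : c i != 0 by rewrite -normr_gt0.
  have hs := tails_shift Mt c0 k00 e1.
  (* Weights in [D] may exceed [k0], so their tails are compared with scale [k0] at the price of a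
     factor [t], harmless against [t ^- 4]. *)
  have hr := slow_ratio (fun x => ltW (K0 x)) (Mnd 1) Ks c0' k00 ltr01.
  near=> t; split.
    suff : Mbar F (c i) (t - 2 * Num.sqrt t) <= Mbar F (c i) t + eps / (2 * n1) * Mbar F 1 (t / k0) /\
    Mbar F (c i) t <= Mbar F (c i) (t + 2 * Num.sqrt t) + eps / (2 * n1) * Mbar F 1 (t / k0) by case.
    by near: t.
  have t0 : 0 < t by near: t; exact: near_gt.
  rewrite (le_trans (CP _ _ c0 _))//.
    by rewrite ler_pdivlMr//; near: t; exact: near_ge.
  rewrite -mulrA ler_wpM2l ?(ltW C0)//.
  rewrite -[X in _ <= X * _](lnK t0) -[ln t]mul1r; near: t; exact: hr.
have hjump := pr_jump_le mX XF Mt a0 B0 d01 ca.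
near=> t => L uL DL cB.
have t1 : 1 <= t by near: t; exact: near_ge.
have t0 : 0 < t by lra.
have tC : 2 * C * n1 / eps <= t by near: t; exact: near_ge.
set tau := Num.sqrt t.
have tau1 : 1 <= tau by rewrite -sqrtr1 ler_sqrt.
pose theta i := `|c i| `^ delta * (tau / (2 * B)).
have th0 i : 0 <= theta i.
  by rewrite mulr_ge0 ?powR_ge0// divr_ge0 ?mulr_ge0 ?ltW//; lra.
have Lth : \sum_(i <- L) theta i <= tau / 2 by exact: sum_theta.
have t10 : 0 <= t + 1 by lra.
have := @pr_sum_ge _ _ _ P X c theta L D (tau / 2) (t + 1) mX iX uL uD DL th0 Lth t10.
set p := \sum_(i <- L) pr P [set w | theta i < `|c i * X i w|].
have /andP[p0 p4] : 0 <= p <= t ^- 4.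
  have : forall L, \sum_(i <- L) `|c i| `^ delta <= B ->
    0 <= \sum_(i <- L) pr P [set w |
    `|c i| `^ delta * (Num.sqrt t / (2 * B)) < `|c i * X i w|] <= t ^- 4 by near: t.
  exact.
set Kt := Mbar F 1 (t / k0).
have Kt0 : 0 < Kt by exact: K0.
move=> /(le_trans _); apply.
have pM j s : pr P [set w | s < c j * X j w] = Mbar F (c j) s.
  by rewrite (Mbar_pr (mX j) (XF j)).
under [X in _ <= X * _]eq_bigr do rewrite pM.
have hDt : forall i, i \in D ->
    Mbar F (c i) t <= Mbar F (c i) (t + 2 * Num.sqrt t) + eps / (2 * n1) * Mbar F 1 (t / k0)
    /\ Mbar F (c i) t <= C * t * Mbar F 1 (t / k0) by near: t.
set A := \sum_(i <- D) Mbar F (c i) (t + 1 + tau / 2).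
have A1 : \sum_(i <- D) Mbar F (c i) t <= A + eps / 2 * Kt.
  apply: (@le_trans _ _ (\sum_(i <- D) (Mbar F (c i) (t + 1 + tau / 2) + eps / (2 * n1) * Kt))).
    rewrite [leLHS]big_seq [leRHS]big_seq; apply: ler_sum => i /hDt[h _].
    by apply: (le_trans h); rewrite lerD2r; apply: Mnd; rewrite -/tau; clear -tau1; lra.
  rewrite big_split/= lerD2l big_const_seq count_predT iter_addr_0 -[leLHS]mulr_natr.
  have -> : eps / (2 * n1) * Kt * (size D)%:R = eps / 2 * Kt * ((size D)%:R / n1).
    by field; rewrite gt_eqF.
  rewrite ger_pMr; last by rewrite mulr_gt0// divr_gt0.
  by rewrite ler_pdivrMr// mul1r lerDl.
have A0 : 0 <= A by apply: sumr_ge0 => i _; case/andP: (M01 (c i) (t + 1 + tau / 2)).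
have A2 : A <= n1 * (C * t * Kt).
  apply: (@le_trans _ _ (\sum_(i <- D) C * t * Kt)).
    rewrite /A [leLHS]big_seq [leRHS]big_seq; apply: ler_sum => i /hDt[_ h].
    by apply: le_trans h; apply: Mnd; clear -tau1; lra.
  rewrite big_const_seq count_predT iter_addr_0 -[leLHS]mulr_natl ler_wpM2r ?lerDl//.
  by rewrite !mulr_ge0 ?ltW.
have A3 : A * p <= eps / 2 * Kt.
  apply: (@le_trans _ _ (n1 * (C * t * Kt) * t ^- 4)).
    by apply: ler_pM.
  have -> : n1 * (C * t * Kt) * t ^- 4 = n1 * C / t ^+ 3 * Kt by field; rewrite gt_eqF.
  rewrite ler_wpM2r ?(ltW Kt0)// ler_pdivrMr ?exprn_gt0//.
  move: tC; rewrite ler_pdivrMr// => tC.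
  have t3 : t <= t ^+ 3 by rewrite exprS ler_peMr ?(ltW t0)// exprn_ege1.
  by have := ler_wpM2l (ltW eps0) t3; clear -tC; lra.
by rewrite mulrBr mulr1; clear -A1 A3; lra.
Unshelve. all: by end_near. Qed.

(** * Infinite sums and the ordering of weights *)

(** [Mbar F (-1) t] is the left limit of [F] at [- t], whereas tail balance speaks of [F (- t)]; a
    possible atom at [- t] has to be absorbed. The final alternative says that the left tail either
    vanishes eventually or is comparable to the right one. *)
Lemma tails_Mbar {R : realType} {d} {T : measurableType d} (P : probability T R)
  (Y : T -> R) (F h hm : R -> R) :
  measurable_fun setT Y -> (forall t, P [set w | Y w <= t] = (F t)%:E) ->
  ((exists t1 : R, forall t, t <= t1 -> F t = 0) \/
   ((exists2 l : R, 0 < l & ((1 - F t) / F (- t)) @[t --> +oo] --> l) /\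
    hazard_rate (Mbar F (-1)) hm /\ hazard_props hm)) ->
  hazard_rate (fun t => 1 - F t) h -> hazard_props h ->
  tails (Mbar F) /\
  ((\forall t \near +oo, Mbar F (-1) t = 0) \/
   exists2 C, 0 < C & \forall t \near +oo, Mbar F 1 t <= C * Mbar F (-1) t).
Proof.
move=> mY YF left_tail hF [_ hy _ hl _].
have ME := Mbar_pr mY YF.
have mS (B : set R) : measurable B -> measurable (Y @^-1` B).
  by move=> mB; rewrite -[X in measurable X]setTI; exact: mY.
have m1 c s : measurable [set w | s < c * Y w] by exact: (mS _ (measurable_lt_mul c s)).
have mle t : measurable [set w | Y w <= t].
  have := mS _ (measurable_itv `]-oo, t]).
  by congr measurable; apply/seteqP; split => w /=; rewrite in_itv.
have FE t : F t = pr P [set w | Y w <= t] by rewrite /pr YF.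
have F0 t : 0 <= F t by rewrite FE pr_ge0.
have M01 c x : 0 <= Mbar F c x <= 1 by rewrite ME pr_ge0 pr_le1.
have Mnd c x y : x <= y -> Mbar F c y <= Mbar F c x.
  by move=> xy; rewrite !ME le_pr// => w /=; apply: le_lt_trans.
have M1E : Mbar F 1 = fun t => 1 - F t.
  by apply/funext => t; rewrite /Mbar ltr01 divr1.
have K0 x : 0 < Mbar F 1 x.
  have [t0 t0P] := hF.
  have [] := t0P (Num.max t0 x); first by rewrite le_max lexx.
  move=> h0 _; rewrite (lt_le_trans h0)// -[leLHS]/((fun t => 1 - F t) _) -M1E.
  by apply: Mnd; rewrite le_max lexx orbT.
have Kd : decay (Mbar F 1) by rewrite M1E; exact: hazard_decay hy.
have Ks : slow (Mbar F 1) by rewrite M1E; exact: hazard_slow hl.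
have MF x : Mbar F (-1) x <= F (- x).
  by rewrite ME FE le_pr// => w /=; rewrite mulN1r ltrNr => /ltW.
suff [Kms [[C C0 KC] two]] : slow (Mbar F (-1)) /\
    ((exists2 C, 0 < C & \forall x \near +oo, Mbar F (-1) x <= C * Mbar F 1 x) /\
  ((\forall t \near +oo, Mbar F (-1) t = 0) \/
   exists2 C, 0 < C & \forall t \near +oo, Mbar F 1 t <= C * Mbar F (-1) t)).
  split=> //; split => //.
  - by move=> x x0; rewrite /Mbar ltxx ltNge x0.
  - move=> c x c0; rewrite !ME; congr (pr P _); apply/seteqP; split => w /=;
      by rewrite mul1r ltr_pdivrMr// mulrC.
  - move=> c x c0; rewrite !ME; congr (pr P _); apply/seteqP; split => w /=;
      by rewrite mulN1r ltr_pdivrMr ?oppr_gt0// mulrNN mulrC.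
  - by split => //; exists C.
have Mm0 x : 0 <= Mbar F (-1) x by case/andP: (M01 (-1) x).
case: left_tail => [[t1 t1P]|[[l l0 Fl] [hm_rate [_ _ _ hml _]]]].
  have z x : - t1 <= x -> Mbar F (-1) x = 0.
    move=> tx; apply/eqP; rewrite eq_le Mm0 andbT (le_trans (MF x))// t1P//; lra.
  split.
    move=> eta eta0; exists (Num.max 1 (- t1)) => [|x y]; first by rewrite le_max lexx.
    rewrite ge_max => /andP[_ tx] _; rewrite z//.
    by rewrite mulr_ge0 ?expR_ge0.
  split; last by left; exists (- t1); split; [exact: num_real|move=> x /ltW; exact: z].
  exists 1 => //; exists (- t1); split; [exact: num_real|move=> x /ltW tx].
  by rewrite z// mul1r ltW.
have Kms : slow (Mbar F (-1)) by exact: hazard_slow hml.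
have [u [_ uP]] : \forall t \near +oo, l / 2 <= (1 - F t) / F (- t) <= 2 * l.
  have l20 : 0 < l / 2 by rewrite divr_gt0.
  move/cvgrPdist_le : Fl => /(_ _ l20) h'.
  near=> t; have : `|l - (1 - F t) / F (- t)| <= l / 2 by near: t; exact: h'.
  by rewrite ler_norml => /andP[? ?]; apply/andP; split; lra.
have [v vP] := hm_rate.
split => //; split.
  exists (2 / l); first by rewrite divr_gt0.
  near=> t; apply: (le_trans (MF t)).
  have /uP/andP[h1 _] : u < t by near: t; exact: near_gt.
  have := F0 (- t); rewrite le_eqVlt => /predU1P[<-|Ft0].
    by rewrite mulr_ge0 ?(ltW (K0 _))// divr_ge0// ltW.
  move: h1; rewrite ler_pdivlMr// M1E => h1.
  by rewrite mulrAC ler_pdivlMr//; lra.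
(* The factor [2 * l] comes from the balance. The other 2 comes from
   [F (- t) <= Mbar F (-1) (t - 1)], where a shift by 1 at most doubles a slow tail. *)
right; exists (2 * l * 2); first by rewrite !mulr_gt0.
have MM : \forall x \near +oo, Mbar F (-1) x <= 1 * Mbar F (-1) x.
  by near=> x; rewrite mul1r.
have hs := slow_shift Mm0 Kms Mm0 (Mnd (-1)) Kms ltr01 MM ltr01 ltr01 ltr01.
near=> t.
have t1 : 1 <= t by near: t; exact: near_ge.
have /uP/andP[_ h1] : u < t by near: t; exact: near_gt.
have [Kt0 _] : 0 < Mbar F (-1) t /\ is_derive t 1 (fun s => 1 - Mbar F (-1) s) (hm t * Mbar F (-1) t).
  by apply: vP; near: t; exact: near_ge.
have Ft0 : 0 < F (- t) by exact: lt_le_trans (MF t).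
move: h1; rewrite ler_pdivrMr// M1E => /le_trans; apply.
rewrite -[leRHS]mulrA ler_wpM2l//; first by rewrite mulr_ge0// ltW.
apply: (@le_trans _ _ (Mbar F (-1) (t - 1))).
  by rewrite ME FE le_pr// => w /=; lra.
apply: (@le_trans _ _ (Mbar F (-1) ((t - 2 * Num.sqrt t) / 1))).
  apply: Mnd; rewrite divr1; have : Num.sqrt 1 <= Num.sqrt t by rewrite ler_sqrt//; lra.
  by rewrite sqrtr1; lra.
have -> : 2 * Mbar F (-1) t = Mbar F (-1) (t / 1) + 1 * Mbar F (-1) (t / 1).
  by rewrite divr1; ring.
by near: t.
Unshelve. all: by end_near. Qed.

(** * The order of weights and the order of their absolute values *)

Lemma tails_upper {R : realType} (M : R -> R -> R) (c : R) :
  tails M -> c != 0 ->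
  exists2 C, 0 < C & \forall t \near +oo, M c t <= C * M 1 (t / `|c|).
Proof.
move=> Mt c0; have [_ _ [C [x1 [C0 CP]]]] := tails_dominated Mt.
exists C => //; near=> t; apply: CP => //.
by rewrite ler_pdivlMr ?normr_gt0//; near: t; exact: near_ge.
Unshelve. all: by end_near. Qed.

Lemma tails_lower {R : realType} (M : R -> R -> R) (c : R) :
  tails M ->
  (\forall t \near +oo, M (-1) t = 0) \/
    (exists2 C, 0 < C & \forall t \near +oo, M 1 t <= C * M (-1) t) ->
  c != 0 ->
  (exists2 C, 0 < C & \forall t \near +oo, M 1 (t / `|c|) <= C * M c t) \/
  \forall t \near +oo, M c t = 0.
Proof.
move=> [_ _ Mp Mn _] two; rewrite neq_lt => /orP[c0|c0]; last first.
  by left; exists 1 => //; near=> t; rewrite mul1r gtr0_norm// -Mp.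
have c0' : 0 < - c by rewrite oppr_gt0.
case: two => [[u [_ z]]|[C C0 [u [_ KC]]]]; [right|left; exists C => //]; near=> t.
  rewrite Mn//; apply: z; rewrite ltr_pdivlMr//; near: t; exact: near_gt.
rewrite (Mn c)// ltr0_norm//; apply: KC; rewrite ltr_pdivlMr//; near: t; exact: near_gt.
Unshelve. all: by end_near. Qed.

Lemma tails_negligible {R : realType} (M : R -> R -> R) (a b eps : R) :
  tails M -> 0 < a -> a < b -> 0 < eps ->
  \forall t \near +oo, M 1 (t / a) <= eps * M 1 (t / b).
Proof.
move=> [_ _ _ _ [Mnd K0 Kd _ _]] a0 ab eps0.
have hneg := decay_negligible (fun x => ltW (K0 x)) (Mnd 1) Kd a0 ab eps0.
near=> t; apply: (@le_trans _ _ (M 1 ((t - Num.sqrt t) / a))); last by near: t.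
by apply: Mnd; rewrite ler_pM2r ?invr_gt0// gerBl sqrtr_ge0.
Unshelve. all: by end_near. Qed.

(** If [k] preceded [c], the tail of [c] would be at least [e] times that of [k]; but a smaller
    modulus makes it at most [e / 2] times that tail, which is positive. *)
Lemma not_wpreceq_small {R : realType} (F : R -> R) (k c C : R) :
  tails (Mbar F) -> 0 < C ->
  (\forall t \near +oo, Mbar F 1 (t / `|k|) <= C * Mbar F k t) ->
  `|c| < `|k| -> ~ wpreceq F k c.
Proof.
move=> Mt C0 kC ck.
have [M01 M0 _ _ [_ K0 _ _ _]] := Mt.
have le_e : wpreceq F k c -> exists2 e, 0 < e & \forall t \near +oo, e * Mbar F k t <= Mbar F c t.
  case=> [/(_ 1 ltr01) h|[e e0 h]]; last first.
    exists e => //; near=> t.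
    suff : e * Mbar F k t <= Mbar F c t /\ Mbar F c t <= e^-1 * Mbar F k t by case.
    by near: t.
  exists 1 => //; near=> t.
  have : `|Mbar F k t| <= 1 * `|Mbar F c t| by near: t.
  by rewrite !mul1r !ger0_norm//; [case/andP: (M01 c t)|case/andP: (M01 k t)].
move=> /le_e[e e0 he].
suff h : \forall t \near +oo, Mbar F c t <= e / (2 * C) * Mbar F 1 (t / `|k|).
  (* The contradiction is derived under the filter, as the absurd [t < t], and then evaluated at one
     large point. *)
  have : \forall t \near +oo, t < t :> R.
    near=> t.
    have h1 : Mbar F 1 (t / `|k|) <= C * Mbar F k t by near: t.
    have h2 : e * Mbar F k t <= Mbar F c t by near: t.
    have h3 : Mbar F c t <= e / (2 * C) * Mbar F 1 (t / `|k|) by near: t.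
    have := K0 (t / `|k|); set x := Mbar F 1 _ in h1 h3 * => x0.
    have h4 : e / (2 * C) * x <= e / 2 * Mbar F k t.
      rewrite (_ : e / (2 * C) * x = e / 2 * (x / C)); last by field; rewrite gt_eqF.
      apply: ler_wpM2l; first by rewrite divr_ge0// ltW.
      by rewrite ler_pdivrMr; [rewrite mulrC|exact: C0].
    have Mk0 : 0 < Mbar F k t by rewrite -(pmulr_rgt0 _ C0) (lt_le_trans x0).
    by have := mulr_gt0 e0 Mk0; clear -h2 h3 h4; lra.
  by move=> [u [_ /(_ (u + 1))]]; rewrite ltrDl ltxx => /(_ ltr01).
have eC : 0 < e / (2 * C) by rewrite divr_gt0 ?mulr_gt0.
have [->|c0] := eqVneq c 0.
  near=> t; have t0 : 0 <= t by near: t; exact: near_ge.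
  by rewrite M0// mulr_ge0 ?(ltW eC)// ltW.
have [C1 C10 hC1] := tails_upper Mt c0.
have e1 : 0 < e / (2 * C) / C1 by rewrite divr_gt0.
have cpos : 0 < `|c| by rewrite normr_gt0.
have hn := tails_negligible Mt cpos ck e1.
near=> t; apply: (@le_trans _ _ (C1 * Mbar F 1 (t / `|c|))); first by near: t.
rewrite (_ : e / (2 * C) * _ = C1 * (e / (2 * C) / C1 * Mbar F 1 (t / `|k|))).
  by rewrite ler_wpM2l ?(ltW C10)//; near: t.
by field; rewrite !gt_eqF.
Unshelve. all: by end_near. Qed.

(** Equal moduli give equivalent tails even for opposite signs; a larger modulus strictly dominates
    by decay. The exception is a negative [c] when the left tail vanishes. *)
Lemma wpreceq_large {R : realType} (F : R -> R) (k c C : R) :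
  tails (Mbar F) ->
  (\forall t \near +oo, Mbar F (-1) t = 0) \/
    (exists2 C, 0 < C & \forall t \near +oo, Mbar F 1 t <= C * Mbar F (-1) t) ->
  k != 0 -> 0 < C -> (\forall t \near +oo, Mbar F 1 (t / `|k|) <= C * Mbar F k t) ->
  `|k| <= `|c| -> wpreceq F k c \/ \forall t \near +oo, Mbar F c t = 0.
Proof.
move=> Mt two k0 C0 kC kc.
have kpos : 0 < `|k| by rewrite normr_gt0.
have c0 : c != 0 by rewrite -normr_gt0 (lt_le_trans kpos).
have [M01 M0 _ _ [_ K0 _ _ _]] := Mt.
have [[C' C'0 cC']|] := tails_lower Mt two c0; last by right.
have [C1 C10 kC1] := tails_upper Mt k0.
have [C2 C20 cC2] := tails_upper Mt c0.
have M0' s t : 0 <= Mbar F s t by case/andP: (M01 s t).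
left; move: kc; rewrite le_eqVlt => /predU1P[kc|kc].
  right; pose A := C1 * C' + C2 * C.
  have A0 : 0 < A by rewrite addr_gt0 ?mulr_gt0.
  exists A^-1; first by rewrite invr_gt0.
  near=> t.
  have h1 : Mbar F 1 (t / `|k|) <= C * Mbar F k t by near: t; exact: kC.
  have h2 : Mbar F 1 (t / `|c|) <= C' * Mbar F c t by near: t; exact: cC'.
  have h3 : Mbar F k t <= C1 * Mbar F 1 (t / `|k|) by near: t; exact: kC1.
  have h4 : Mbar F c t <= C2 * Mbar F 1 (t / `|c|) by near: t; exact: cC2.
  rewrite -kc in h2 h4; rewrite invrK ler_pdivrMl; last exact: A0.
  split.
    apply: (le_trans h3); apply: (@le_trans _ _ (C1 * (C' * Mbar F c t))).
      by rewrite ler_wpM2l ?(ltW C10).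
    by rewrite mulrA ler_wpM2r// lerDl mulr_ge0 ?ltW.
  apply: (le_trans h4); apply: (@le_trans _ _ (C2 * (C * Mbar F k t))).
    by rewrite ler_wpM2l ?(ltW C20).
  by rewrite mulrA ler_wpM2r// lerDr mulr_ge0 ?ltW.
left=> eps eps0.
have e1 : 0 < eps / (C1 * C') by rewrite divr_gt0 ?mulr_gt0.
have hn := tails_negligible Mt kpos kc e1.
near=> t; rewrite !ger0_norm//.
have h2 : Mbar F 1 (t / `|c|) <= C' * Mbar F c t by near: t.
have h3 : Mbar F k t <= C1 * Mbar F 1 (t / `|k|) by near: t.
have h4 : Mbar F 1 (t / `|k|) <= eps / (C1 * C') * Mbar F 1 (t / `|c|) by near: t.
apply: (le_trans h3); apply: (le_trans (ler_wpM2l (ltW C10) h4)).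
rewrite (_ : C1 * (eps / (C1 * C') * Mbar F 1 (t / `|c|)) = eps / C' * Mbar F 1 (t / `|c|)); last
   by field; rewrite !gt_eqF.
apply: (le_trans (ler_wpM2l _ h2)); first by rewrite divr_ge0 ?ltW.
by rewrite mulrA divfK// gt_eqF.
Unshelve. all: by end_near. Qed.

(** * From symmetric partial sums to the series *)

Definition window n : seq int := [seq k%:Z - n%:Z | k <- index_iota 0 n.*2.+1].

Lemma window_uniq n : uniq (window n).
Proof. by rewrite map_inj_uniq ?iota_uniq// => x y /addIr[]. Qed.

Lemma mem_window n i : (i \in window n) = (`|i|%N <= n)%N.
Proof.
apply/mapP/idP => [[k]|ni]; first by rewrite mem_index_iota => kn ->; lia.
exists (absz (i + n%:Z)); first by rewrite mem_index_iota; lia.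
by lia.
Qed.

Lemma psum_window {R : realType} (c x : int -> R) n :
  psum c x n = \sum_(i <- window n) c i * x i.
Proof. by rewrite /psum big_map. Qed.

(** [k1] is a maximum over the finite list. The floor [k0 / 2] lets it also bound the weights
    outside a large window. *)
Lemma gap_below {R : realType} (I : eqType) (r : seq I) (f : I -> R) (k0 : R) : 0 < k0 ->
  exists k1, [/\ k0 / 2 <= k1, k1 < k0 & forall i, i \in r -> f i < k0 -> f i <= k1].
Proof.
move=> k00; elim: r => [|i r [k1 [k1l k1k0 IH]]]; first by exists (k0 / 2); split=> //; lra.
exists (if f i < k0 then Num.max (f i) k1 else k1); split.
- by case: ifP => // _; rewrite le_max k1l orbT.
- by case: ifP => // fi; rewrite gt_max fi.
move=> j; rewrite inE => /predU1P[->|jr] fj; first by rewrite fj le_max lexx.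
by case: ifP => _; rewrite ?le_max IH ?orbT.
Qed.

Lemma weights_window {R : realType} (c : int -> R) (k0 : R) :
  0 < k0 -> (c (Posz n) @[n --> \oo] --> 0) -> (c (Negz n) @[n --> \oo] --> 0) ->
  exists N, forall i, i \notin window N -> `|c i| <= k0 / 2.
Proof.
move=> k00 /cvgrPdist_le cp /cvgrPdist_le cn.
have k02 : 0 < k0 / 2 by rewrite divr_gt0.
have [N1 _ N1P] := cp _ k02; have [N2 _ N2P] := cn _ k02.
exists (maxn N1 N2); case => n; rewrite mem_window -ltnNge => h.
  have := N1P n; rewrite /= sub0r normrN; apply; lia.
have := N2P n; rewrite /= sub0r normrN; apply; lia.
Qed.

Lemma pr_series {R : realType} {d} {T : measurableType d} (P : probability T R)
  (X : int -> T -> R) (F : R -> R) (c : int -> R) (S : T -> R) (B delta k0 eps : R) :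
  (forall i, measurable_fun setT (X i)) -> mutually_independent P X ->
  (forall i t, P [set w | X i w <= t] = (F t)%:E) -> tails (Mbar F) ->
  (c (Posz n) @[n --> \oo] --> 0) -> (c (Negz n) @[n --> \oo] --> 0) ->
  measurable_fun setT S ->
  {ae P, forall w, psum c (X ^~ w) n @[n --> \oo] --> S w} ->
  0 < delta < 1 -> (forall n, \sum_(i <- window n) `|c i| `^ delta <= B) ->
  0 < k0 -> 0 < eps ->
  exists D : seq int, [/\ uniq D, forall i, (i \in D) = (k0 <= `|c i|) &
    \forall t \near +oo, `|pr P [set w | t < S w] - \sum_(i <- D) Mbar F (c i) t|
      <= eps * Mbar F 1 (t / k0)].
Proof.
move=> mX iX XF Mt cp cn mS Sae d01 cB k00 eps0.
have [N NP] := weights_window k00 cp cn.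
have [k1 [k1l k10 k1P]] := gap_below (window N) (fun i => `|c i|) k00.
have k1pos : 0 < k1 by apply: lt_le_trans k1l; rewrite divr_gt0.
have gap i : `|c i| < k0 -> `|c i| <= k1.
  move=> ck; have [iN|iN] := boolP (i \in window N); first exact: k1P.
  by apply: le_trans k1l; exact: NP.
(* A bound for all weights at once: those in the window by the sum, the others by [k0 / 2]. *)
pose a := k0 + \sum_(i <- window N) `|c i|.
have sum0 : 0 <= \sum_(i <- window N) `|c i| by exact: sumr_ge0.
have a0 : 0 < a by rewrite /a; lra.
have ca i : `|c i| <= a.
  have [iN|iN] := boolP (i \in window N); last first.
    by apply: (le_trans (NP _ iN)); rewrite /a; lra.
  rewrite /a (perm_big _ (perm_to_rem iN)) big_cons/= addrCA lerDl addr_ge0 ?(ltW k00)//.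
  exact: sumr_ge0.
pose D := [seq i <- window N | k0 <= `|c i|].
have uD : uniq D by rewrite filter_uniq// window_uniq.
have DE i : (i \in D) = (k0 <= `|c i|).
  rewrite mem_filter; have [kc|//] := boolP (k0 <= `|c i|).
  have [//|/NP h] := boolP (i \in window N); lra.
have DN n : (N <= n)%N -> {subset D <= window n}.
  move=> Nn i; rewrite mem_filter !mem_window => /andP[_ iN].
  exact: leq_trans iN Nn.
pose B' := `|B| + 1.
have B'0 : 0 < B' by rewrite ltr_wpDl.
have cB' n : \sum_(i <- window n) `|c i| `^ delta <= B'.
  by apply: (le_trans (cB n)); rewrite (le_trans (ler_norm B))// lerDl.
have hu := pr_sum_upper mX iX XF Mt a0 B'0 d01 ca k1pos k10 gap uD DE eps0.
have DE' i : i \in D -> k0 <= `|c i| by rewrite DE.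
have hl := pr_sum_lower mX iX XF Mt a0 B'0 d01 ca k00 uD DE' eps0.
have mSB (E : set R) : measurable E -> measurable (S @^-1` E).
  by move=> mE; rewrite -[X in measurable X]setTI; exact: mS.
have mSt t : measurable [set w | t < S w].
  have := mSB _ (measurable_itv `]t, +oo[).
  by congr measurable; apply/seteqP; split => w /=; rewrite in_itv/= andbT.
have mAn t n : measurable [set w | t < \sum_(i <- window n) c i * X i w].
  rewrite (_ : mkset _ = (fun w => \sum_(i <- window n) c i * X i w) @^-1` `]t, +oo[%classic).
    rewrite -[X in measurable X]setTI; apply: measurable_sum => // i.
    by apply: measurable_funM.
  by apply/seteqP; split => w /=; rewrite in_itv/= andbT.
exists D; split => //; near=> t.
have ut L : uniq L -> {subset D <= L} -> \sum_(i <- L) `|c i| `^ delta <= B' ->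
    pr P [set w | t < \sum_(i <- L) c i * X i w] <=
    \sum_(i <- D) Mbar F (c i) t + eps * Mbar F 1 (t / k0).
  by move: L; near: t.
have lt L : uniq L -> {subset D <= L} -> \sum_(i <- L) `|c i| `^ delta <= B' ->
    \sum_(i <- D) Mbar F (c i) t - eps * Mbar F 1 (t / k0) <=
    pr P [set w | t + 1 < \sum_(i <- L) c i * X i w].
  by move: L; near: t.
have h1 : pr P [set w | t < S w] <= \sum_(i <- D) Mbar F (c i) t + eps * Mbar F 1 (t / k0).
  apply: (ge_ae_limit (An := fun n => [set w | t < \sum_(i <- window n) c i * X i w]) (n0 := N)) => //.
    apply: filterS Sae => w /cvgrPdist_lt Sw /= tS.
    have e0 : 0 < S w - t by rewrite subr_gt0.
    apply: filterS (Sw _ e0) => n; rewrite psum_window => /(le_lt_trans (ler_norm _)).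
    by lra.
  by move=> n Nn; apply: ut; [exact: window_uniq|exact: DN|exact: cB'].
(* Only upper bounds pass to the limit through [ge_ae_limit], so the lower bound is obtained on the
   complement. *)
have h2 : pr P (~` [set w | t < S w]) <=
    1 - (\sum_(i <- D) Mbar F (c i) t - eps * Mbar F 1 (t / k0)).
  apply: (ge_ae_limit (An := fun n => ~` [set w | t + 1 < \sum_(i <- window n) c i * X i w]) (n0 := N)).
  - exact: measurableC.
  - by move=> n; exact: measurableC.
  - apply: filterS Sae => w /cvgrPdist_lt Sw /= /negP; rewrite -leNgt => tS.
    apply: filterS (Sw _ ltr01) => n; rewrite psum_window distrC => /(le_lt_trans (ler_norm _)) h.
    by apply/negP; rewrite -leNgt; lra.
  - move=> n Nn; rewrite prC// lerD2l lerN2.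
    by apply: lt; [exact: window_uniq|exact: DN|exact: cB'].
rewrite prC// in h2.
by rewrite ler_norml; apply/andP; split; clear -h1 h2; lra.
Unshelve. all: by end_near. Qed.

Theorem theorem2p3p2 (R : realType) (d : measure_display) (T : measurableType d)
    (P : probability T R) (X : int -> T -> R) (F : R -> R)
    (c : int -> R) (S : T -> R) (G : R -> R) (h hm : R -> R) :
  (* independent random variables with common distribution function F *)
  (forall i, measurable_fun setT (X i)) ->
  mutually_independent P X ->
  (forall i t, P [set w | X i w <= t] = (F t)%:E) ->
  (* weights tending to 0 at infinity *)
  (c (Posz n) @[n --> \oo] --> 0) -> (c (Negz n) @[n --> \oo] --> 0) ->
  (* S = sum_i c_i X_i (a.s. limit of the partial sums), G its distribution function *)
  measurable_fun setT S ->
  {ae P, forall w, psum c (X ^~ w) n @[n --> \oo] --> S w} ->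
  (forall t, P [set w | S w <= t] = (G t)%:E) ->
  (* standard conditions *)
  (exists2 delta : R, 0 < delta < 1 &
     exists B : R, forall n, \sum_(0 <= k < n.*2.+1) `|c (k%:Z - n%:Z)| `^ delta <= B) ->
  ((exists t1 : R, forall t, t <= t1 -> F t = 0) \/
   (* strongly tail balanced *)
   ((exists2 l : R, 0 < l & ((1 - F t) / F (- t)) @[t --> +oo] --> l) /\
    hazard_rate (Mbar F (-1)) hm /\ hazard_props hm)) ->
  (* hazard rate h of F and its assumed properties *)
  hazard_rate (fun t => 1 - F t) h ->
  hazard_props h ->
  forall cs : nat -> R, ordered_weights F c cs ->
  forall m : nat, (1 <= m)%N -> ~ wequiv F (cs m) 0 ->
  forall eps : R, 0 < eps ->
    \forall t \near +oo,
      (`| (1 - G t)%:E - \esum_(i in [set i | wpreceq F (cs m) (c i)]) (Mbar F (c i) t)%:E |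
        <= (eps * Mbar F (cs m) t)%:E)%E.
Proof.
move=> mX iX XF cp cn mS Sae SG [delta d01 [B hB]] left_tail hF hp cs _ m _ nk eps eps0.
have [Mt two] := tails_Mbar (mX 0) (XF 0) left_tail hF hp.
have [M01 M0 _ _ [_ K0 _ _ _]] := Mt.
set k := cs m in nk *.
have k_neq0 : k != 0.
  apply/eqP => k0; apply: nk; rewrite k0; exists 1 => //.
  by near=> t; rewrite invr1 mul1r.
(* If the tail of [k] vanished eventually, [k] would be equivalent to 0, as is the case for a
   negative [k] with a vanishing left tail. *)
have [[C C0 kC]|z] := tails_lower Mt two k_neq0; last first.
  exfalso; apply: nk; exists 1 => //; near=> t.
  have -> : Mbar F k t = 0 by near: t.
  by rewrite M0 ?mulr0//; near: t; exact: near_ge.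
have k_gt0 : 0 < `|k| by rewrite normr_gt0.
have cB n : \sum_(i <- window n) `|c i| `^ delta <= B by rewrite big_map.
(* The series estimate has its error at scale [|k|] of the right tail; dividing by [C] converts it
   to the tail of [k] itself. *)
have eC : 0 < eps / C by rewrite divr_gt0.
have [D [uD DE hD]] := pr_series mX iX XF Mt cp cn mS Sae d01 cB k_gt0 eC.
pose I := [set i | wpreceq F k (c i)].
have ID i : I i -> i \in D.
  rewrite DE leNgt => Ii; apply/negP => ck; exact: (not_wpreceq_small Mt C0 kC ck Ii).
(* [D] selects by modulus, [I] by the order of weights. They differ only by indices whose tails are
   eventually zero, and finiteness of [D] gives one threshold for all of them. *)
have DI : \forall t \near +oo, forall i, i \in D -> I i \/ Mbar F (c i) t = 0.
  apply: near_all_seq => i; rewrite DE => kc.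
  have [Ii|z] := wpreceq_large Mt two k_neq0 C0 kC kc; first by near=> t; left.
  by near=> t; right; near: t.
have mSt t : measurable [set w | S w <= t].
  have := mS measurableT _ (measurable_itv `]-oo, t]); rewrite setTI.
  by congr measurable; apply/seteqP; split => w /=; rewrite in_itv.
near=> t.
have GE : 1 - G t = pr P [set w | t < S w].
  have -> : G t = pr P [set w | S w <= t] by rewrite /pr SG.
  rewrite -prC//; congr (pr P _); apply/seteqP; split => w /=.
    by move/negP; rewrite -ltNge.
  by move=> h'; apply/negP; rewrite -ltNge.
have IE : I = [set` [seq i <- D | `[< I i >]]].
  apply/seteqP; split => i /=; rewrite mem_filter; last by move=> /andP[/asboolP].
  by move=> Ii; rewrite ID// andbT; apply/asboolP.
have DIt : forall i, i \in D -> I i \/ Mbar F (c i) t = 0 by near: t.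
have -> : (\esum_(i in I) (Mbar F (c i) t)%:E = (\sum_(i <- D) Mbar F (c i) t)%:E)%E.
  rewrite esum_fset; [|by rewrite IE; exact: finite_seq|].
    rewrite IE -fsbig_seq ?filter_uniq// big_filter sumEFin; congr EFin.
    rewrite [RHS](bigID (fun i => `[< I i >]))/= [X in _ + X]big1_seq ?addr0//.
    by move=> i /andP[/asboolP nI /DIt[]].
  by move=> i _; rewrite lee_fin; case/andP: (M01 (c i) t).
rewrite -EFinB abse_EFin lee_fin GE.
have hDt : `|pr P [set w | t < S w] - \sum_(i <- D) Mbar F (c i) t| <=
  eps / C * Mbar F 1 (t / `|k|) by near: t.
apply: (le_trans hDt).
have kCt : Mbar F 1 (t / `|k|) <= C * Mbar F k t by near: t.
have -> : eps * Mbar F k t = eps / C * (C * Mbar F k t) by field; rewrite gt_eqF.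
by rewrite ler_wpM2l// ltW.
Unshelve. all: by end_near. Qed.
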